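(* Consider a 5-manifold with coordinates $(\psi,\theta,\phi,x,q)$, $\sin\theta\ne0$, and $\sigma_i,E^i$ the left-invariant 1-forms and dual vector fields of $SU(2)$ in Euler angles $(\psi,\theta,\phi)$ (see context). For either choice of sign (upper signs throughout or lower signs throughout), let $D^{\mp}$ be the complex rank 2 distribution spanned by $$X^1=\partial_x+E^2,\qquad X^{2\mp}=\partial_q+ e^{\mp \frac{i}{3}x} E^1\mp \tfrac{i}{3} e^{\mp \frac{i}{3}x} E^3 .$$ Let $$o_1=\sigma_1-e^{\mp\frac{i}{3}x}dq,\quad o_2=\sigma_2-dx,\quad o_3=\sigma_3\pm \tfrac{i}{3}e^{\mp \frac{i}{3}x}dq,\quad o_4=-dx,\quad o_5=e^{\mp\frac{i}{3}x}dq$$ (so $o_1,o_2,o_3$ span the annihilator of $D^{\mp}$) and $$\tilde{o}_1=\sigma_1+e^{\mp\frac{i}{3}x}dq, \quad \tilde{o}_2=\sigma_2+dx,\quad \tilde{o}_3=o_3$$ (which span the annihilator of the sign-reversed distribution $\tilde D^{\mp}$). Then $D^{\mp}$ is maximally symmetric and a representative metric of Nurowski's conformal class associated to $D^{\mp}$ is $$g_{\mp}=-2(o_4 o_4+o_5o_5)+\tfrac{1}{2}\tilde{o}_1\tilde{o}_1+\tfrac{1}{2}\tilde{o}_2\tilde{o}_2+\tfrac{1}{2}\tilde{o}_3 \tilde{o}_3+(o_1o_1+o_2o_2+o_3o_3)$$ $$=-(\omega_4 \omega_4+\omega_5 \omega_5)+(\sigma_1\sigma_1+\sigma_2\sigma_2)+\tfrac{1}{2}(\omega_1\omega_1+\omega_2\omega_2)+\tfrac{3}{2}\omega_3\omega_3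 .$$ The metric $g_{\mp}$ is conformally flat.
   Context: Products of 1-forms are symmetric products. All vector fields, 1-forms and metrics are complex-valued, and all notions (brackets, annihilators, metrics, Weyl tensor) are extended complex-linearly. Left-invariant forms and vector fields on $SU(2)\cong S^3$ in Euler angles $(\psi,\theta,\phi)$: $$\sigma_1=\sin\psi\,d\theta-\cos\psi\sin\theta\,d\phi,\quad \sigma_2=\cos\psi\,d\theta+\sin\psi\sin\theta\,d\phi,\quad \sigma_3=-d\psi-\cos\theta\,d\phi,$$ with dual vector fields $$E^1=\sin\psi\,\partial_\theta+\cos\psi\left(\cot\theta\,\partial_\psi-\tfrac{1}{\sin\theta}\partial_\phi\right),\quad E^2=\cos\psi\,\partial_\theta-\sin\psi\left(\cot\theta\,\partial_\psi-\tfrac{1}{\sin\theta}\partial_\phi\right),\quad E^3=-\partial_\psi .$$ The sign-reversed distribution $\tilde D^\mp$ is the kernel of $\tilde o_1,\tilde o_2,\tilde o_3$. Rolling forms: with $f(\theta)=-\sin\theta$ and $h(x)=e^{\mp\frac{i}{3}x}$, put $\chi_1=d\theta$, $\chi_2=f\,d\phi$, $\chi_3=dx$, $\chi_4=h\,dq$ and $$\omega_1=\chi_1-\cos\psi\,\chi_3-\sin\psi\,\chi_4,\quad \omega_2=\chi_2+\sin\psi\,\chi_3-\cos\psi\,\chi_4,\quad \omega_3=d\psi+\tfrac{h_x}{h}\chi_4-\tfrac{f_\theta}{f}\chi_2,$$ $$\omega_4=\sin\psi\,\chi_3-\cos\psi\,\chi_4,\quad \omega_5=\cos\psi\,\chi_3+\sin\psi\,\chi_4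 .$$ A $(2,3,5)$-distribution on a 5-manifold is a rank 2 distribution $D$ with $[D,D]$ of rank 3 and $[[D,D],D]$ the full tangent bundle. Nurowski's conformal class of $D$: locally there exist a coframe $(\theta_1,\dots,\theta_5)$ with $D=\ker(\theta_1,\theta_2,\theta_3)$ and 1-forms $\Omega_1,\dots,\Omega_7$ satisfying Cartan's structure equations $$d\theta_1=\theta_1\wedge(2\Omega_1+\Omega_4)+\theta_2\wedge\Omega_2+\theta_3\wedge\theta_4,$$ $$d\theta_2=\theta_1\wedge\Omega_3+\theta_2\wedge(\Omega_1+2\Omega_4)+\theta_3\wedge\theta_5,$$ $$d\theta_3=\theta_1\wedge\Omega_5+\theta_2\wedge\Omega_6+\theta_3\wedge(\Omega_1+\Omega_4)+\theta_4\wedge\theta_5,$$ $$d\theta_4=\theta_1\wedge\Omega_7+\tfrac43\theta_3\wedge\Omega_6+\theta_4\wedge\Omega_1+\theta_5\wedge\Omega_2,$$ $$d\theta_5=\theta_2\wedge\Omega_7-\tfrac43\theta_3\wedge\Omega_5+\theta_4\wedge\Omega_3+\theta_5\wedge\Omega_4,$$ and the class is that of $g=2\theta_1\theta_5-2\theta_2\theta_4+\frac43\theta_3\theta_3$, up to multiplication by nowhere-zero functions. $D$ is called maximally symmetric when $g$ has vanishing Weyl tensor. *)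

(* Defs.v *)
From Stdlib Require Export Reals.
From Coquelicot Require Export Coquelicot.

Open Scope C_scope.

Inductive coord : Set := cpsi | ctheta | cphi | cx | cq.

Definition coord_eq_dec (i j : coord) : {i = j} + {i <> j}.
Proof. decide equality. Defined.

(* The topology on [point] is the one of Coquelicot's [fct_UniformSpace], which
   is the product topology of R^5 because [coord] is finite. *)
Definition point := coord -> R.

Definition update (p : point) (i : coord) (t : R) : point :=
  fun j => if coord_eq_dec i j then t else p j.

Definition delta (i j : coord) : C := if coord_eq_dec i j then 1 else 0.

Definition sumc (f : coord -> C) : C :=
  f cpsi + f ctheta + f cphi + f cx + f cq.

(* f 1 + ... + f n *)
Fixpoint Csum (n : nat) (f : nat -> C) : C :=
  match n with
  | O => 0
  | S m => Csum m f + f n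
  end.

(** ** Smooth complex-valued functions of real variables *)

Definition Cderiv (f : R -> C) (t : R) : C :=
  (Derive (fun u => Re (f u)) t, Derive (fun u => Im (f u)) t).

Definition ex_Cderiv (f : R -> C) (t : R) : Prop :=
  ex_derive (fun u => Re (f u)) t /\ ex_derive (fun u => Im (f u)) t.

Definition pd (i : coord) (f : point -> C) : point -> C :=
  fun p => Cderiv (fun t => f (update p i t)) (p i).

Definition ex_pd (i : coord) (f : point -> C) (p : point) : Prop :=
  ex_Cderiv (fun t => f (update p i t)) (p i).

Fixpoint Ck (k : nat) (V : point -> Prop) (f : point -> C) : Prop :=
  match k with
  | O => forall p, V p -> continuous f p
  | S k' => Ck k' V f /\
            forall i, (forall p, V p -> ex_pd i f p) /\ Ck k' V (pd i f)
  end.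

Definition smooth (V : point -> Prop) (f : point -> C) : Prop :=
  forall k, Ck k V f.

(** ** Complex vector fields and 1-forms *)

(* Components in the coordinate (co)frame; [delta j] is both the vector d/dj
   and the covector dj. *)
Definition vec := coord -> C.
Definition covec := coord -> C.
Definition vfield := point -> vec.
Definition form := point -> covec.

Definition contract (a : covec) (v : vec) : C := sumc (fun i => a i * v i).

Definition smooth_field (V : point -> Prop) (X : point -> coord -> C) : Prop :=
  forall i, smooth V (fun p => X p i).

Definition lie_bracket (X Y : vfield) : vfield :=
  fun p i => sumc (fun j => X p j * pd j (fun q => Y q i) p
                            - Y p j * pd j (fun q => X q i) p).

(* A 2-form is given by its values on pairs of coordinate vector fields, with
   (a /\ b)(v,w) = a(v) b(w) - a(w) b(v) and
   da(v,w) = v(a(w)) - w(a(v)) - a([v,w]). *)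
Definition form2 := point -> coord -> coord -> C.

Definition wedge (a b : form) : form2 :=
  fun p i j => a p i * b p j - a p j * b p i.

Definition ext_d (a : form) : form2 :=
  fun p i j => pd i (fun q => a q j) p - pd j (fun q => a q i) p.

Definition fadd (a b : form) : form := fun p i => a p i + b p i.
Definition fscal (c : C) (a : form) : form := fun p i => c * a p i.

(** ** Linear algebra in the complexified (co)tangent spaces *)

(* Families of n vectors are indexed by 1, ..., n. *)
Definition lin_comb (n : nat) (c : nat -> C) (b : nat -> coord -> C)
  : coord -> C := fun i => Csum n (fun k => c k * b k i).

Definition lin_indep (n : nat) (b : nat -> coord -> C) : Prop :=
  forall c, (forall i, lin_comb n c b i = 0) ->
  forall k, (1 <= k <= n)%nat -> c k = 0.

Definition is_basis (n : nat) (b : nat -> coord -> C)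
  (W : (coord -> C) -> Prop) : Prop :=
  lin_indep n b /\
  forall v, W v <-> exists c, forall i, v i = lin_comb n c b i.

Definition in_span (S : (coord -> C) -> Prop) (v : coord -> C) : Prop :=
  exists n c b, (forall k, (1 <= k <= n)%nat -> S (b k)) /\
                forall i, v i = lin_comb n c b i.

(** ** Distributions *)

Definition distribution := point -> vec -> Prop.

Definition rank_dist (n : nat) (U : point -> Prop) (D : distribution) : Prop :=
  forall p, U p -> exists (V : point -> Prop) (b : nat -> vfield),
    open V /\ V p /\
    (forall k, (1 <= k <= n)%nat -> smooth_field V (b k)) /\
    forall q, V q -> is_basis n (fun k => b k q) (D q).

Definition smooth_section (V : point -> Prop) (D : distribution) (X : vfield)
  : Prop := smooth_field V X /\ forall p, V p -> D p (X p).

Definition bracket_dist (D E : distribution) : distribution :=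
  fun p => in_span (fun w => exists (V : point -> Prop) (X Y : vfield),
    open V /\ V p /\ smooth_section V D X /\ smooth_section V E Y /\
    w = lie_bracket X Y p).

Definition distribution_235 (U : point -> Prop) (D : distribution) : Prop :=
  rank_dist 2 U D /\
  rank_dist 3 U (bracket_dist D D) /\
  forall p, U p -> forall v, bracket_dist (bracket_dist D D) D p v.

Definition span2 (X Y : vfield) : distribution :=
  fun p v => exists a b : C, forall i, v i = a * X p i + b * Y p i.

Definition ker3 (a b c : form) : distribution :=
  fun p v =>
    contract (a p) v = 0 /\ contract (b p) v = 0 /\ contract (c p) v = 0.

Definition spans_annihilator3 (U : point -> Prop) (a b c : form)
  (D : distribution) : Prop :=
  forall p, U p -> forall al : covec,
    (forall v, D p v -> contract al v = 0) <->
    exists x y z : C, forall i, al i = x * a p i + y * b p i + z * c p i.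

(** ** Complex metrics and curvature *)

Definition tensor2 := point -> coord -> coord -> C.

Definition sprod (a b : form) : tensor2 :=
  fun p i j => (a p i * b p j + a p j * b p i) / 2.

Definition rescale (l : point -> C) (g : tensor2) : tensor2 :=
  fun p i j => l p * g p i j.

(* [g] is a smooth nondegenerate symmetric tensor on [V] with inverse [gi]. *)
Definition metric_with_inverse (V : point -> Prop) (g gi : tensor2) : Prop :=
  (forall i j, smooth V (fun p => g p i j)) /\
  (forall p, V p -> forall i j, g p i j = g p j i) /\
  (forall p, V p -> forall i j,
     sumc (fun k => g p i k * gi p k j) = delta i j).

(* Gamma^k_ij *)
Definition christoffel (g gi : tensor2) (k i j : coord) : point -> C :=
  fun p => / 2 * sumc (fun l => gi p k l *
    (pd i (fun q => g q j l) p + pd j (fun q => g q i l) p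
     - pd l (fun q => g q i j) p)).

(* l-th component of R(d_i, d_j) d_k *)
Definition riemann (g gi : tensor2) (i j k l : coord) : point -> C :=
  fun p =>
    pd i (christoffel g gi l j k) p - pd j (christoffel g gi l i k) p
    + sumc (fun m => christoffel g gi l i m p * christoffel g gi m j k p
                     - christoffel g gi l j m p * christoffel g gi m i k p).

(* g(R(d_i, d_j) d_k, d_l) *)
Definition riemann_low (g gi : tensor2) (i j k l : coord) : point -> C :=
  fun p => sumc (fun m => riemann g gi i j k m p * g p m l).

Definition ricci (g gi : tensor2) (j k : coord) : point -> C :=
  fun p => sumc (fun i => riemann g gi i j k i p).

Definition scalar_curv (g gi : tensor2) : point -> C :=
  fun p => sumc (fun j => sumc (fun k => gi p j k * ricci g gi j k p)).

(* The coefficients are 1/(n-2) and 1/((n-1)(n-2)) for n = 5. *)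
Definition weyl (g gi : tensor2) (i j k l : coord) : point -> C :=
  fun p =>
    riemann_low g gi i j k l p
    - / 3 * (g p i l * ricci g gi j k p - g p i k * ricci g gi j l p
             + g p j k * ricci g gi i l p - g p j l * ricci g gi i k p)
    + scalar_curv g gi p / 12 * (g p i l * g p j k - g p i k * g p j l).

Definition weyl_vanishes (V : point -> Prop) (g : tensor2) : Prop :=
  exists gi, metric_with_inverse V g gi /\
    forall p, V p -> forall i j k l, weyl g gi i j k l p = 0.

Definition flat (V : point -> Prop) (g : tensor2) : Prop :=
  exists gi, metric_with_inverse V g gi /\
    forall p, V p -> forall i j k l, riemann g gi i j k l p = 0.

Definition conformal_factor (V : point -> Prop) (l : point -> C) : Prop :=
  smooth V l /\ forall p, V p -> l p <> 0.

Definition conformally_flat (U : point -> Prop) (g : tensor2) : Prop :=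
  forall p, U p -> exists (V : point -> Prop) (l : point -> C),
    open V /\ V p /\ (forall q, V q -> U q) /\
    conformal_factor V l /\ flat V (rescale l g).

(** ** Nurowski's conformal class *)

Definition cartan_structure (V : point -> Prop)
  (t1 t2 t3 t4 t5 O1 O2 O3 O4 O5 O6 O7 : form) : Prop :=
  forall p, V p -> forall i j,
  ext_d t1 p i j = wedge t1 (fadd (fscal 2 O1) O4) p i j
    + wedge t2 O2 p i j + wedge t3 t4 p i j /\
  ext_d t2 p i j = wedge t1 O3 p i j
    + wedge t2 (fadd O1 (fscal 2 O4)) p i j + wedge t3 t5 p i j /\
  ext_d t3 p i j = wedge t1 O5 p i j + wedge t2 O6 p i j
    + wedge t3 (fadd O1 O4) p i j + wedge t4 t5 p i j /\
  ext_d t4 p i j = wedge t1 O7 p i j + 4 / 3 * wedge t3 O6 p i j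
    + wedge t4 O1 p i j + wedge t5 O2 p i j /\
  ext_d t5 p i j = wedge t2 O7 p i j - 4 / 3 * wedge t3 O5 p i j
    + wedge t4 O3 p i j + wedge t5 O4 p i j.

Definition family5 (t1 t2 t3 t4 t5 : form) (k : nat) : form :=
  match k with
  | 1%nat => t1 | 2%nat => t2 | 3%nat => t3 | 4%nat => t4 | _ => t5
  end.

Definition cartan_coframe (V : point -> Prop) (D : distribution)
  (t1 t2 t3 t4 t5 : form) : Prop :=
  (forall k, smooth_field V (family5 t1 t2 t3 t4 t5 k)) /\
  (forall p, V p -> lin_indep 5 (fun k => family5 t1 t2 t3 t4 t5 k p)) /\
  (forall p, V p -> forall v, D p v <-> ker3 t1 t2 t3 p v) /\
  exists O1 O2 O3 O4 O5 O6 O7 : form,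
    smooth_field V O1 /\ smooth_field V O2 /\ smooth_field V O3 /\
    smooth_field V O4 /\ smooth_field V O5 /\ smooth_field V O6 /\
    smooth_field V O7 /\
    cartan_structure V t1 t2 t3 t4 t5 O1 O2 O3 O4 O5 O6 O7.

Definition cartan_metric (t1 t2 t3 t4 t5 : form) : tensor2 :=
  fun p i j => 2 * sprod t1 t5 p i j - 2 * sprod t2 t4 p i j
               + 4 / 3 * sprod t3 t3 p i j.

Definition nurowski_representative (U : point -> Prop) (D : distribution)
  (g : tensor2) : Prop :=
  forall p, U p -> exists (V : point -> Prop) (t1 t2 t3 t4 t5 : form)
                          (l : point -> C),
    open V /\ V p /\ (forall q, V q -> U q) /\
    cartan_coframe V D t1 t2 t3 t4 t5 /\ conformal_factor V l /\
    forall q, V q -> forall i j,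
      g q i j = rescale l (cartan_metric t1 t2 t3 t4 t5) q i j.

(* By Cartan the metrics of all such coframes of D are conformal to each other,
   and vanishing of the Weyl tensor is conformally invariant, so the condition
   does not depend on the coframe chosen. *)
Definition maximally_symmetric (U : point -> Prop) (D : distribution) : Prop :=
  forall p, U p -> exists (V : point -> Prop) (t1 t2 t3 t4 t5 : form),
    open V /\ V p /\ (forall q, V q -> U q) /\
    cartan_coframe V D t1 t2 t3 t4 t5 /\
    weyl_vanishes V (cartan_metric t1 t2 t3 t4 t5).

(** ** Left-invariant forms and vector fields of SU(2) in Euler angles *)

Definition sigma_1 : form := fun p i =>
  sin (p cpsi) * delta ctheta i
  - cos (p cpsi) * sin (p ctheta) * delta cphi i.
Definition sigma_2 : form := fun p i =>
  cos (p cpsi) * delta ctheta i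
  + sin (p cpsi) * sin (p ctheta) * delta cphi i.
Definition sigma_3 : form := fun p i =>
  - delta cpsi i - cos (p ctheta) * delta cphi i.

Definition cot (t : R) : R := (cos t / sin t)%R.

Definition E_1 : vfield := fun p i =>
  sin (p cpsi) * delta ctheta i
  + cos (p cpsi) * (cot (p ctheta) * delta cpsi i
                    - / sin (p ctheta) * delta cphi i).
Definition E_2 : vfield := fun p i =>
  cos (p cpsi) * delta ctheta i
  - sin (p cpsi) * (cot (p ctheta) * delta cpsi i
                    - / sin (p ctheta) * delta cphi i).
Definition E_3 : vfield := fun p i => - delta cpsi i.

(** ** The distributions and the metrics *)

Inductive sign_choice : Set := Upper | Lower.

(* The values of the minus-or-plus and plus-or-minus signs. *)
Definition mp (s : sign_choice) : C :=
  match s with Upper => -1 | Lower => 1 end.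
Definition pm (s : sign_choice) : C :=
  match s with Upper => 1 | Lower => -1 end.

Definition Cexp (z : C) : C :=
  (exp (Re z) * cos (Im z), exp (Re z) * sin (Im z))%R.

Definition h_roll (s : sign_choice) (x : R) : C := Cexp (mp s * (Ci / 3) * x).

Definition X_1 : vfield := fun p i => delta cx i + E_2 p i.
Definition X_2 (s : sign_choice) : vfield := fun p i =>
  delta cq i + h_roll s (p cx) * E_1 p i
  + mp s * (Ci / 3) * h_roll s (p cx) * E_3 p i.

Definition dist_D (s : sign_choice) : distribution := span2 X_1 (X_2 s).

Definition o_1 (s : sign_choice) : form := fun p i =>
  sigma_1 p i - h_roll s (p cx) * delta cq i.
Definition o_2 : form := fun p i => sigma_2 p i - delta cx i.
Definition o_3 (s : sign_choice) : form := fun p i =>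
  sigma_3 p i + pm s * (Ci / 3) * h_roll s (p cx) * delta cq i.
Definition o_4 : form := fun p i => - delta cx i.
Definition o_5 (s : sign_choice) : form := fun p i =>
  h_roll s (p cx) * delta cq i.

Definition ot_1 (s : sign_choice) : form := fun p i =>
  sigma_1 p i + h_roll s (p cx) * delta cq i.
Definition ot_2 : form := fun p i => sigma_2 p i + delta cx i.
Definition ot_3 (s : sign_choice) : form := o_3 s.

Definition dist_Dt (s : sign_choice) : distribution :=
  ker3 (ot_1 s) ot_2 (ot_3 s).

Definition g_o (s : sign_choice) : tensor2 := fun p i j =>
  - 2 * (sprod o_4 o_4 p i j + sprod (o_5 s) (o_5 s) p i j)
  + / 2 * sprod (ot_1 s) (ot_1 s) p i j
  + / 2 * sprod ot_2 ot_2 p i j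
  + / 2 * sprod (ot_3 s) (ot_3 s) p i j
  + (sprod (o_1 s) (o_1 s) p i j + sprod o_2 o_2 p i j
     + sprod (o_3 s) (o_3 s) p i j).

(** ** Rolling forms *)

Definition f_roll (t : R) : R := (- sin t)%R.

Definition chi_1 : form := fun p i => delta ctheta i.
Definition chi_2 : form := fun p i => f_roll (p ctheta) * delta cphi i.
Definition chi_3 : form := fun p i => delta cx i.
Definition chi_4 (s : sign_choice) : form := fun p i =>
  h_roll s (p cx) * delta cq i.

Definition omega_1 (s : sign_choice) : form := fun p i =>
  chi_1 p i - cos (p cpsi) * chi_3 p i - sin (p cpsi) * chi_4 s p i.
Definition omega_2 (s : sign_choice) : form := fun p i =>
  chi_2 p i + sin (p cpsi) * chi_3 p i - cos (p cpsi) * chi_4 s p i.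
Definition omega_3 (s : sign_choice) : form := fun p i =>
  delta cpsi i + Cderiv (h_roll s) (p cx) / h_roll s (p cx) * chi_4 s p i
  - Derive f_roll (p ctheta) / f_roll (p ctheta) * chi_2 p i.
Definition omega_4 (s : sign_choice) : form := fun p i =>
  sin (p cpsi) * chi_3 p i - cos (p cpsi) * chi_4 s p i.
Definition omega_5 (s : sign_choice) : form := fun p i =>
  cos (p cpsi) * chi_3 p i + sin (p cpsi) * chi_4 s p i.

Definition g_rolling (s : sign_choice) : tensor2 := fun p i j =>
  - (sprod (omega_4 s) (omega_4 s) p i j + sprod (omega_5 s) (omega_5 s) p i j)
  + (sprod sigma_1 sigma_1 p i j + sprod sigma_2 sigma_2 p i j)
  + / 2 * (sprod (omega_1 s) (omega_1 s) p i j
           + sprod (omega_2 s) (omega_2 s) p i j)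
  + 3 / 2 * sprod (omega_3 s) (omega_3 s) p i j.

(* Main.v *)
(**
In the coframe (sigma_1, sigma_2, sigma_3, dx, h dq), with h = e^(-+ i x/3),
all forms of the theorem have constant coefficients, and the coframe has
constant structure functions, those of SU(2) times the affine group of a line.
A Cartan coframe with constant coefficients is therefore found by linear
algebra: theta_i = (9/8) o_i for i = 1, 2, 3, theta_4 = o_4 - (3/4) o_2 and
theta_5 = o_5 + (3/4) o_1, whose Cartan metric is (9/8) g. The metric h^-2 g is
flat: g is conformally flat by a global factor.

In the coordinates of the statement all components are polynomials in
cos psi, sin psi, cos theta, (sin theta)^(+-1), h^(+-1). These functions form a
ring which is stable under partial derivatives and in which equality is decided
by a normal form, so the structure equations and the vanishing of curvatures
are established by computation in this ring.
*)

From Stdlib Require Import List QArith Qreals FunctionalExtensionality Bool.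
From Stdlib Require Import Lra Lia.
Require Import Defs.
Open Scope C_scope.

(** * Partial derivatives and smoothness *)

(** Both signs are covered by one computation. The sign enters only through the logarithmic
    derivative a of h, and the ring uses only h' = a h and a^2 = -1/9. This value has a geometric
    origin: dx^2 + h^2 dq^2 has Gaussian curvature -a^2 = 1/9, so D is the complexified rolling of a
    unit sphere on a surface of curvature 1/9, the ratio at which the symmetry becomes that of the
    exceptional group G2. Two points are not identities in the ring. First, [pd] is built on the
    total operator [Derive]; derivatives are therefore computed in the relational form [is_pd],
    which also carries existence, before they are read off as values of [pd]. Second, the fibre of
    [D,D] is spanned by brackets of arbitrary local smooth sections, so brackets of a frame bound it
    only from below. The bound from above comes from Cartan's formula, by which only the
    restrictions of d(o_1) and d(o_2) to D matter. *)

Definition is_pd (i : coord) (f : point -> C) (p : point) (l : C) : Prop :=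
  is_derive (fun t => Re (f (update p i t))) (p i) (Re l) /\
  is_derive (fun t => Im (f (update p i t))) (p i) (Im l).

Lemma C_eq (z w : C) : Re z = Re w -> Im z = Im w -> z = w.
Proof. destruct z, w; cbn; congruence. Qed.

Lemma update_same (p : point) (i : coord) : update p i (p i) = p.
Proof.
  apply functional_extensionality; intro j; unfold update.
  destruct (coord_eq_dec i j) as [->|]; reflexivity.
Qed.

Lemma is_pd_unique (i : coord) (f : point -> C) (p : point) (l : C) :
  is_pd i f p l -> pd i f p = l.
Proof.
  intros [Hr Hi]; apply C_eq; cbn; now apply is_derive_unique.
Qed.

Lemma is_pd_ex (i : coord) (f : point -> C) (p : point) (l : C) :
  is_pd i f p l -> ex_pd i f p.
Proof. intros [Hr Hi]; split; eexists; eassumption. Qed.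

Lemma ex_pd_is_pd (i : coord) (f : point -> C) (p : point) :
  ex_pd i f p -> is_pd i f p (pd i f p).
Proof. intros [Hr Hi]; split; apply Derive_correct; assumption. Qed.

Lemma is_pd_const (i : coord) (c : C) (p : point) :
  is_pd i (fun _ => c) p 0.
Proof.
  split; exact (is_derive_const (K := R_AbsRing) (V := R_NormedModule) _ _).
Qed.

Lemma is_pd_plus (i : coord) (f g : point -> C) (p : point) (l m : C) :
  is_pd i f p l -> is_pd i g p m -> is_pd i (fun q => f q + g q) p (l + m).
Proof.
  intros [Hfr Hfi] [Hgr Hgi]; split.
  - exact (is_derive_plus _ _ _ _ _ Hfr Hgr).
  - exact (is_derive_plus _ _ _ _ _ Hfi Hgi).
Qed.

Lemma is_pd_mult (i : coord) (f g : point -> C) (p : point) (l m : C) :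
  is_pd i f p l -> is_pd i g p m ->
  is_pd i (fun q => f q * g q) p (l * g p + f p * m).
Proof.
  intros [Hfr Hfi] [Hgr Hgi].
  pose proof (Derive.is_derive_mult _ _ _ _ _ Hfr Hgr) as Hrr.
  pose proof (Derive.is_derive_mult _ _ _ _ _ Hfi Hgi) as Hii.
  pose proof (Derive.is_derive_mult _ _ _ _ _ Hfr Hgi) as Hri.
  pose proof (Derive.is_derive_mult _ _ _ _ _ Hfi Hgr) as Hir.
  cbv beta in Hrr, Hii, Hri, Hir.
  (* The real product rule leaves the factors evaluated at [update p i (p i)], which is [p]. *)
  rewrite !update_same in Hrr, Hii, Hri, Hir.
  assert (Er : Re (l * g p + f p * m) =
    ((Re l * Re (g p) + Re (f p) * Re m)
     - (Im l * Im (g p) + Im (f p) * Im m))%R) by (unfold Re, Im; cbn; ring).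
  assert (Ei : Im (l * g p + f p * m) =
    ((Re l * Im (g p) + Re (f p) * Im m)
     + (Im l * Re (g p) + Im (f p) * Re m))%R) by (unfold Re, Im; cbn; ring).
  split; [rewrite Er | rewrite Ei].
  - exact (is_derive_minus _ _ _ _ _ Hrr Hii).
  - exact (is_derive_plus _ _ _ _ _ Hri Hir).
Qed.

Lemma is_pd_real (i : coord) (f : point -> R) (p : point) (l : R) :
  is_derive (fun t => f (update p i t)) (p i) l ->
  is_pd i (fun q => RtoC (f q)) p l.
Proof. intro H; split; [exact H|];
  exact (is_derive_const (K := R_AbsRing) (V := R_NormedModule) _ _). Qed.

(** Coordinate lines through a point of an open set stay in it for a while. This makes partial
    derivatives local: identities known only on [V] may be differentiated there. *)
Lemma open_update (V : point -> Prop) (p : point) (i : coord) :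
  open V -> V p -> locally (p i) (fun t => V (update p i t)).
Proof.
  intros HV Hp; destruct (HV p Hp) as [e He]; exists e; intros t Ht.
  apply He; intro j; unfold update.
  destruct (coord_eq_dec i j) as [<-|]; [exact Ht | apply ball_center].
Qed.

Lemma is_pd_ext (V : point -> Prop) (i : coord) (f g : point -> C)
  (p : point) (l : C) :
  open V -> V p -> (forall q, V q -> f q = g q) ->
  is_pd i f p l -> is_pd i g p l.
Proof.
  intros HV Hp Hfg [Hr Hi].
  pose proof (open_update V p i HV Hp) as HL; split.
  - eapply is_derive_ext_loc; [|exact Hr].
    eapply filter_imp; [|exact HL]; intros t Ht; cbn; now rewrite Hfg.
  - eapply is_derive_ext_loc; [|exact Hi].
    eapply filter_imp; [|exact HL]; intros t Ht; cbn; now rewrite Hfg.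
Qed.

Lemma pd_ext (V : point -> Prop) (i : coord) (f g : point -> C) (p : point) :
  open V -> V p -> (forall q, V q -> f q = g q) -> pd i f p = pd i g p.
Proof.
  intros HV Hp Hfg; pose proof (open_update V p i HV Hp) as HL.
  apply C_eq; cbn; apply Derive_ext_loc;
    (eapply filter_imp; [|exact HL]; intros t Ht; cbn; now rewrite Hfg).
Qed.

(** * Continuity and the classes C^k for complex-valued functions *)

Lemma continuous_proj (i : coord) (p : point) :
  continuous (fun q : point => q i) p.
Proof.
  intros P [e He]; exists e; intros q Hq; apply He; exact (Hq i).
Qed.

Lemma continuous_C (f : point -> C) (p : point) :
  continuous (fun q => Re (f q)) p -> continuous (fun q => Im (f q)) p ->
  continuous f p.
Proof.
  intros Hr Hi P [e He].
  specialize (Hr _ (locally_ball (Re (f p)) e)).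
  specialize (Hi _ (locally_ball (Im (f p)) e)).
  unfold filtermap in *.
  generalize (filter_and _ _ Hr Hi); apply filter_imp; intros q [Hq1 Hq2].
  apply He; split; assumption.
Qed.

Lemma continuous_Re (f : point -> C) (p : point) :
  continuous f p -> continuous (fun q => Re (f q)) p.
Proof.
  intros Hf P [e He]; apply (Hf (fun z => P (Re z))).
  exists e; intros z [Hz _]; apply He; exact Hz.
Qed.

Lemma continuous_Im (f : point -> C) (p : point) :
  continuous f p -> continuous (fun q => Im (f q)) p.
Proof.
  intros Hf P [e He]; apply (Hf (fun z => P (Im z))).
  exists e; intros z [_ Hz]; apply He; exact Hz.
Qed.

Lemma continuous_Cplus (f g : point -> C) (p : point) :
  continuous f p -> continuous g p -> continuous (fun q => f q + g q) p.
Proof.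
  intros Hf Hg; apply continuous_C.
  - exact (continuous_plus (V := R_NormedModule) _ _ _
      (continuous_Re _ _ Hf) (continuous_Re _ _ Hg)).
  - exact (continuous_plus (V := R_NormedModule) _ _ _
      (continuous_Im _ _ Hf) (continuous_Im _ _ Hg)).
Qed.

Lemma continuous_Cmult (f g : point -> C) (p : point) :
  continuous f p -> continuous g p -> continuous (fun q => f q * g q) p.
Proof.
  intros Hf Hg.
  pose proof (continuous_Re _ _ Hf) as Hfr.
  pose proof (continuous_Im _ _ Hf) as Hfi.
  pose proof (continuous_Re _ _ Hg) as Hgr.
  pose proof (continuous_Im _ _ Hg) as Hgi.
  apply continuous_C.
  - exact (continuous_minus (V := R_NormedModule) _ _ _
      (continuous_mult (K := R_AbsRing) _ _ _ Hfr Hgr)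
      (continuous_mult (K := R_AbsRing) _ _ _ Hfi Hgi)).
  - exact (continuous_plus (V := R_NormedModule) _ _ _
      (continuous_mult (K := R_AbsRing) _ _ _ Hfr Hgi)
      (continuous_mult (K := R_AbsRing) _ _ _ Hfi Hgr)).
Qed.

Lemma continuous_RtoC (f : point -> R) (p : point) :
  continuous f p -> continuous (fun q => RtoC (f q)) p.
Proof.
  intro Hf; apply continuous_C; [exact Hf | apply continuous_const].
Qed.

(** Openness is essential in the inductive step: agreement of [f] and [g] on [V] must be passed on
    to [pd i f] and [pd i g]. *)
Lemma Ck_ext (V : point -> Prop) (HV : open V) (k : nat) :
  forall f g : point -> C, (forall p, V p -> f p = g p) -> Ck k V f -> Ck k V g.
Proof.
  induction k as [|k IH]; cbn; intros f g Hfg Hf.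
  - intros p Hp; apply (continuous_ext_loc _ f); [|exact (Hf p Hp)].
    eapply filter_imp; [|exact (HV p Hp)]; intros q Hq; now apply Hfg.
  - destruct Hf as [Hf Hd]; split; [now apply (IH f)|].
    intro i; destruct (Hd i) as [He Hk]; split.
    + intros p Hp; eapply is_pd_ex, (is_pd_ext V i f); eauto.
      now apply ex_pd_is_pd, He.
    + apply (IH (pd i f)); [|exact Hk]; intros p Hp; now apply (pd_ext V).
Qed.

Lemma smooth_ex_pd (V : point -> Prop) (f : point -> C) (i : coord)
  (p : point) : smooth V f -> V p -> ex_pd i f p.
Proof. intros Hf Hp; exact (proj1 (proj2 (Hf 1%nat) i) p Hp). Qed.

(** * Trigonometric Laurent polynomials *)

(* [(x, y)] stands for [x + y a], where [a = -+ i/3] is the logarithmic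
   derivative of the rolling function h, so that [a^2 = -1/9]. *)
Definition coef := (Q * Q)%type.

Definition roll_rate (s : sign_choice) : C := mp s * (Ci / 3).

Definition cden (s : sign_choice) (c : coef) : C :=
  Q2R (fst c) + Q2R (snd c) * roll_rate s.

(** [Qred] keeps the fractions in lowest terms; otherwise numerators and denominators would grow
    throughout the curvature computations. *)
Definition cadd (c d : coef) : coef :=
  (Qred (fst c + fst d), Qred (snd c + snd d))%Q.
Definition cmul (c d : coef) : coef :=
  (Qred (fst c * fst d - snd c * snd d / 9),
   Qred (fst c * snd d + snd c * fst d))%Q.
Definition copp (c : coef) : coef := (- fst c, - snd c)%Q.
Definition czero (c : coef) : bool :=
  Qeq_bool (fst c) 0 && Qeq_bool (snd c) 0.

(* The monomial
   cos psi ^ n_cp * sin psi ^ n_sp * cos theta ^ n_ct * sin theta ^ n_st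
   * h ^ n_h. *)
Record mono := Mono
  { n_cp : nat; n_sp : nat; n_ct : nat; n_st : Z; n_h : Z }.

(** Integer powers of h are written as one exponential, so that negative powers, products and
    derivatives all follow from the exponential law. *)
Definition h_pow (s : sign_choice) (n : Z) (x : R) : C :=
  Cexp (IZR n * (roll_rate s * x)).

Definition mden (s : sign_choice) (m : mono) (p : point) : C :=
  RtoC (cos (p cpsi) ^ n_cp m) * RtoC (sin (p cpsi) ^ n_sp m)
  * RtoC (cos (p ctheta) ^ n_ct m) * RtoC (powerRZ (sin (p ctheta)) (n_st m))
  * h_pow s (n_h m) (p cx).

Definition mmul (m n : mono) : mono :=
  Mono (n_cp m + n_cp n) (n_sp m + n_sp n) (n_ct m + n_ct n)
       (n_st m + n_st n) (n_h m + n_h n).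

Definition mono_eqb (m n : mono) : bool :=
  Nat.eqb (n_cp m) (n_cp n) && Nat.eqb (n_sp m) (n_sp n)
  && Nat.eqb (n_ct m) (n_ct n) && Z.eqb (n_st m) (n_st n)
  && Z.eqb (n_h m) (n_h n).

Definition poly := list (coef * mono).

Definition den (s : sign_choice) (P : poly) (p : point) : C :=
  fold_right (fun t z => cden s (fst t) * mden s (snd t) p + z) 0 P.

(** No order on monomials is maintained. Merging like terms and dropping cancelled ones is enough
    for the difference of equal normal forms to collapse to [nil]. *)
Fixpoint insert (t : coef * mono) (P : poly) : poly :=
  match P with
  | nil => if czero (fst t) then nil else t :: nil
  | t' :: P' =>
      if mono_eqb (snd t) (snd t') then
        let c := cadd (fst t) (fst t') in
        if czero c then P' else (c, snd t) :: P'
      else t' :: insert t P'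
  end.

Definition padd (P Q : poly) : poly := fold_right insert Q P.

(* [reduce] rewrites cos^2 as 1 - sin^2. Only its soundness is proved: if it
   missed a normal form, [peqb] would merely answer [false]. *)
Definition reduce_psi (t : coef * mono) : poly :=
  let (c, m) := t in
  match n_cp m with
  | S (S k) =>
      (c, Mono k (n_sp m) (n_ct m) (n_st m) (n_h m))
      :: (copp c, Mono k (2 + n_sp m) (n_ct m) (n_st m) (n_h m)) :: nil
  | _ => t :: nil
  end.
Definition reduce_theta (t : coef * mono) : poly :=
  let (c, m) := t in
  match n_ct m with
  | S (S k) =>
      (c, Mono (n_cp m) (n_sp m) k (n_st m) (n_h m))
      :: (copp c, Mono (n_cp m) (n_sp m) k (2 + n_st m) (n_h m)) :: nil
  | _ => t :: nil
  end.
Definition reduce (P : poly) : poly :=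
  flat_map reduce_theta (flat_map reduce_psi P).

Definition pmul (P Q : poly) : poly :=
  fold_right (fun t R =>
    padd (reduce (map (fun t' => (cmul (fst t) (fst t'), mmul (snd t) (snd t')))
                      Q)) R) nil P.

Definition pconst (c : coef) : poly :=
  if czero c then nil else (c, Mono 0 0 0 0 0) :: nil.
Definition popp (P : poly) : poly := map (fun t => (copp (fst t), snd t)) P.
Definition psub (P Q : poly) : poly := padd P (popp Q).
Definition peqb (P Q : poly) : bool :=
  match psub P Q with nil => true | _ => false end.

Definition cnat (n : nat) : coef := (inject_Z (Z.of_nat n), 0%Q).
Definition cint (n : Z) : coef := (inject_Z n, 0%Q).

(** The truncated [pred 0] is harmless, because the coefficient in front of it is then 0. The
    exponents of sin theta and h are integers, where no truncation occurs. The pair with first entry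
    0 in the case [cx] is n a, from the derivative n a h^n of h^n. *)
Definition mdiff (i : coord) (m : mono) : poly :=
  match i with
  | cpsi =>
      (copp (cnat (n_cp m)),
       Mono (pred (n_cp m)) (1 + n_sp m) (n_ct m) (n_st m) (n_h m))
      :: (cnat (n_sp m),
          Mono (1 + n_cp m) (pred (n_sp m)) (n_ct m) (n_st m) (n_h m)) :: nil
  | ctheta =>
      (copp (cnat (n_ct m)),
       Mono (n_cp m) (n_sp m) (pred (n_ct m)) (1 + n_st m) (n_h m))
      :: (cint (n_st m),
          Mono (n_cp m) (n_sp m) (1 + n_ct m) (n_st m - 1) (n_h m)) :: nil
  | cx => ((0%Q, inject_Z (n_h m)), m) :: nil
  | cphi | cq => nil
  end.

Definition pdiff (i : coord) (P : poly) : poly :=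
  fold_right (fun t R =>
    padd (reduce (map (fun t' => (cmul (fst t) (fst t'), snd t'))
                      (mdiff i (snd t)))) R) nil P.

(** * Soundness of the polynomial arithmetic under evaluation *)

Lemma roll_rate_sqr (s : sign_choice) : roll_rate s * roll_rate s = - / 9.
Proof.
  assert (Hi : Ci * Ci = -1) by (apply C_eq; cbn; ring).
  unfold roll_rate.
  replace (mp s * (Ci / 3) * (mp s * (Ci / 3)))
    with (mp s * mp s * (Ci * Ci) / 9).
  - rewrite Hi; destruct s; cbn; field.
  - field.
Qed.

Lemma cden_add (s : sign_choice) (c d : coef) :
  cden s (cadd c d) = cden s c + cden s d.
Proof.
  unfold cden, cadd; cbn [fst snd].
  rewrite !(Qeq_eqR _ _ (Qred_correct _)), !Q2R_plus, !RtoC_plus; ring.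
Qed.

Lemma cden_mul (s : sign_choice) (c d : coef) :
  cden s (cmul c d) = cden s c * cden s d.
Proof.
  unfold cden, cmul; cbn [fst snd]; unfold Qdiv.
  rewrite !(Qeq_eqR _ _ (Qred_correct _)), Q2R_minus, Q2R_plus, !Q2R_mult.
  rewrite RtoC_minus, RtoC_plus, !RtoC_mult.
  replace (RtoC (Q2R (/ 9))) with (/ 9)
    by (unfold Q2R; cbn; rewrite <- RtoC_inv; f_equal; lra).
  generalize (roll_rate_sqr s); generalize (roll_rate s); intros r Hr.
  transitivity (Q2R (fst c) * Q2R (fst d)
    + (Q2R (fst c) * Q2R (snd d) + Q2R (snd c) * Q2R (fst d)) * r
    + Q2R (snd c) * Q2R (snd d) * (r * r)); [rewrite Hr|]; ring.
Qed.

Lemma cden_opp (s : sign_choice) (c : coef) : cden s (copp c) = - cden s c.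
Proof.
  unfold cden, copp; cbn [fst snd]; rewrite !Q2R_opp, !RtoC_opp; ring.
Qed.

Lemma cden_czero (s : sign_choice) (c : coef) :
  czero c = true -> cden s c = 0.
Proof.
  unfold czero, cden; rewrite andb_true_iff.
  intros [H1%Qeq_bool_eq%Qeq_eqR H2%Qeq_bool_eq%Qeq_eqR].
  rewrite H1, H2, RMicromega.Q2R_0; ring.
Qed.

Lemma cden_cint (s : sign_choice) (n : Z) : cden s (cint n) = RtoC (IZR n).
Proof.
  unfold cden, cint; cbn [fst snd]; rewrite RMicromega.Q2R_0.
  unfold Q2R, inject_Z; cbn; rewrite Rinv_1, Rmult_1_r; ring.
Qed.

Lemma mono_eqb_eq (m n : mono) : mono_eqb m n = true -> m = n.
Proof.
  unfold mono_eqb; rewrite !andb_true_iff, !Nat.eqb_eq, !Z.eqb_eq.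
  destruct m, n; cbn; intros [[[[-> ->] ->] ->] ->]; reflexivity.
Qed.

Lemma den_nil (s : sign_choice) (p : point) : den s nil p = 0.
Proof. reflexivity. Qed.

Lemma den_cons (s : sign_choice) (t : coef * mono) (P : poly) (p : point) :
  den s (t :: P) p = cden s (fst t) * mden s (snd t) p + den s P p.
Proof. reflexivity. Qed.

Lemma den_insert (s : sign_choice) (t : coef * mono) (P : poly) (p : point) :
  den s (insert t P) p = cden s (fst t) * mden s (snd t) p + den s P p.
Proof.
  induction P as [|t' P IH]; cbn [insert].
  { destruct (czero (fst t)) eqn:Z; [|reflexivity].
    rewrite (cden_czero s _ Z), den_nil; ring. }
  destruct (mono_eqb (snd t) (snd t')) eqn:E.
  - apply mono_eqb_eq in E.
    pose proof (cden_add s (fst t) (fst t')) as Hc.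
    destruct (czero (cadd (fst t) (fst t'))) eqn:Z.
    + apply (cden_czero s) in Z; rewrite Hc in Z.
      rewrite den_cons, <- E, Cplus_assoc, <- Cmult_plus_distr_r, Z; ring.
    + rewrite !den_cons, <- E; cbn [fst snd]; rewrite Hc; ring.
  - rewrite !den_cons, IH; ring.
Qed.

Lemma den_padd (s : sign_choice) (P Q : poly) (p : point) :
  den s (padd P Q) p = den s P p + den s Q p.
Proof.
  unfold padd; induction P as [|t P IH]; cbn [fold_right].
  - cbn [map mdiff fold_right app]; rewrite ?den_nil; ring.
  - rewrite den_insert, den_cons, IH; ring.
Qed.

Lemma den_app (s : sign_choice) (P Q : poly) (p : point) :
  den s (P ++ Q) p = den s P p + den s Q p.
Proof.
  induction P as [|t P IH]; cbn [app].
  - cbn [map mdiff fold_right app]; rewrite ?den_nil; ring.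
  - rewrite !den_cons, IH; ring.
Qed.

Lemma den_flat_map (s : sign_choice) (p : point) (F : coef * mono -> poly)
  (HF : forall t, den s (F t) p = cden s (fst t) * mden s (snd t) p)
  (P : poly) : den s (flat_map F P) p = den s P p.
Proof.
  induction P as [|t P IH]; cbn [flat_map]; [reflexivity|].
  rewrite den_app, HF, IH; reflexivity.
Qed.

Lemma RtoC_sqr_cos (x : R) : RtoC (cos x) * RtoC (cos x) =
  1 - RtoC (sin x) * RtoC (sin x).
Proof.
  rewrite <- !RtoC_mult, <- RtoC_minus; f_equal.
  pose proof (sin2_cos2 x) as H; unfold Rsqr in H; lra.
Qed.

Lemma den_reduce_psi (s : sign_choice) (p : point) (t : coef * mono) :
  den s (reduce_psi t) p = cden s (fst t) * mden s (snd t) p.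
Proof.
  destruct t as [c m]; unfold reduce_psi; cbn [fst snd].
  destruct (n_cp m) as [|[|k]] eqn:E;
    try (rewrite den_cons, den_nil; cbn [fst snd]; ring).
  rewrite !den_cons; cbn [fst snd]; rewrite cden_opp.
  unfold mden; rewrite E; cbn [n_cp n_sp n_ct n_st n_h Nat.add pow].
  rewrite !RtoC_mult.
  pose proof (RtoC_sqr_cos (p cpsi)) as H.
  match goal with |- ?L = cden s c * (?x * (?x * ?y) * ?z * ?u * ?v * ?w) =>
    transitivity (cden s c * ((x * x) * y * z * u * v * w)); [|ring] end.
  rewrite H; cbn [den fold_right]; ring.
Qed.

(** For x = 0 and n = -2 the two sides would be 1 and 0. Negative exponents of sin theta are the
    reason why evaluation is multiplicative only where sin theta is nonzero. *)
Lemma powerRZ_plus2 (x : R) (n : Z) : x <> 0%R ->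
  powerRZ x (2 + n) = (x * x * powerRZ x n)%R.
Proof.
  intro Hx; rewrite powerRZ_add by exact Hx.
  change (powerRZ x 2) with (x * (x * 1))%R; ring.
Qed.

Lemma den_reduce_theta (s : sign_choice) (p : point)
  (Hp : sin (p ctheta) <> 0%R) (t : coef * mono) :
  den s (reduce_theta t) p = cden s (fst t) * mden s (snd t) p.
Proof.
  destruct t as [c m]; unfold reduce_theta; cbn [fst snd].
  destruct (n_ct m) as [|[|k]] eqn:E;
    try (rewrite den_cons, den_nil; cbn [fst snd]; ring).
  rewrite !den_cons; cbn [fst snd]; rewrite cden_opp.
  unfold mden; rewrite E; cbn [n_cp n_sp n_ct n_st n_h pow].
  rewrite powerRZ_plus2 by exact Hp.
  rewrite !RtoC_mult.
  pose proof (RtoC_sqr_cos (p ctheta)) as H.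
  match goal with |- ?L = cden s c * (?z * ?u * (?x * (?x * ?y)) * ?v * ?w) =>
    transitivity (cden s c * (z * u * ((x * x) * y) * v * w)); [|ring] end.
  rewrite H; cbn [den fold_right]; ring.
Qed.

Lemma den_reduce (s : sign_choice) (p : point) (Hp : sin (p ctheta) <> 0%R)
  (P : poly) : den s (reduce P) p = den s P p.
Proof.
  unfold reduce; rewrite (den_flat_map s p reduce_theta),
    (den_flat_map s p reduce_psi); auto using den_reduce_psi, den_reduce_theta.
Qed.

Lemma Cexp_plus (z w : C) : Cexp (z + w) = Cexp z * Cexp w.
Proof.
  apply C_eq; unfold Cexp, Re, Im; cbn; rewrite exp_plus;
    [rewrite cos_plus | rewrite sin_plus]; ring.
Qed.

Lemma mden_mul (s : sign_choice) (p : point) (Hp : sin (p ctheta) <> 0%R)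
  (m n : mono) : mden s (mmul m n) p = mden s m p * mden s n p.
Proof.
  unfold mden, mmul; cbn [n_cp n_sp n_ct n_st n_h].
  rewrite !pow_add, powerRZ_add, !RtoC_mult by exact Hp.
  unfold h_pow; rewrite plus_IZR, RtoC_plus.
  rewrite Cmult_plus_distr_r, Cexp_plus; ring.
Qed.

Lemma den_pmul (s : sign_choice) (p : point) (Hp : sin (p ctheta) <> 0%R)
  (P Q : poly) : den s (pmul P Q) p = den s P p * den s Q p.
Proof.
  unfold pmul; induction P as [|t P IH]; cbn [fold_right].
  - cbn [map mdiff fold_right app]; rewrite ?den_nil; ring.
  - rewrite den_padd, den_reduce, IH, den_cons, Cmult_plus_distr_r by exact Hp.
    apply (f_equal2 Cplus); [clear IH|reflexivity].
    induction Q as [|t' Q IHQ]; cbn [map].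
    + cbn [map mdiff fold_right app]; rewrite ?den_nil; ring.
    + rewrite !den_cons, IHQ; cbn [fst snd].
      rewrite cden_mul, mden_mul by exact Hp; ring.
Qed.

Lemma den_popp (s : sign_choice) (P : poly) (p : point) :
  den s (popp P) p = - den s P p.
Proof.
  unfold popp; induction P as [|t P IH]; cbn [map].
  - cbn [map mdiff fold_right app]; rewrite ?den_nil; ring.
  - rewrite !den_cons, IH; cbn [fst snd]; rewrite cden_opp; ring.
Qed.

Lemma den_psub (s : sign_choice) (P Q : poly) (p : point) :
  den s (psub P Q) p = den s P p - den s Q p.
Proof. unfold psub; rewrite den_padd, den_popp; reflexivity. Qed.

Lemma Cexp_0 : Cexp 0 = 1.
Proof.
  apply C_eq; unfold Cexp; cbn; rewrite exp_0, ?cos_0, ?sin_0; ring.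
Qed.

Lemma mden_1 (s : sign_choice) (p : point) : mden s (Mono 0 0 0 0 0) p = 1.
Proof.
  unfold mden, h_pow; cbn [n_cp n_sp n_ct n_st n_h pow powerRZ].
  replace (0 * (roll_rate s * p cx)) with (RtoC 0) by ring.
  rewrite Cexp_0; ring.
Qed.

Lemma den_pconst (s : sign_choice) (c : coef) (p : point) :
  den s (pconst c) p = cden s c.
Proof.
  unfold pconst; destruct (czero c) eqn:E.
  - now rewrite (cden_czero s c E).
  - rewrite den_cons; cbn [fst snd]; rewrite mden_1; rewrite ?den_nil; ring.
Qed.

Lemma peqb_den (s : sign_choice) (P Q : poly) (p : point) :
  peqb P Q = true -> den s P p = den s Q p.
Proof.
  unfold peqb; destruct (psub P Q) as [|] eqn:E; [intros _|discriminate].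
  pose proof (den_psub s P Q p) as H; rewrite E in H; cbn in H.
  replace (den s P p) with (den s Q p + (den s P p - den s Q p)) by ring.
  rewrite <- H; ring.
Qed.

(** * Derivatives, continuity and smoothness of evaluated polynomials *)

Lemma is_derive_powerRZ (n : Z) (x : R) : x <> 0%R ->
  is_derive (fun t => powerRZ t n) x (IZR n * powerRZ x (n - 1))%R.
Proof.
  intro Hx; destruct n as [|n|n].
  - cbn; rewrite Rmult_0_l.
    exact (is_derive_const (K := R_AbsRing) (V := R_NormedModule) _ _).
  - cbn [powerRZ].
    replace (IZR (Z.pos n) * powerRZ x (Z.pos n - 1))%R
      with (INR (Pos.to_nat n) * 1 * x ^ pred (Pos.to_nat n))%R.
    + apply (is_derive_pow (fun t => t)).
      exact (is_derive_id (K := R_AbsRing) x).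
    + rewrite INR_IZR_INZ, Znat.positive_nat_Z, Rmult_1_r; f_equal.
      rewrite pow_powerRZ; f_equal; lia.
  - replace (Z.neg n) with (- Z.of_nat (Pos.to_nat n))%Z by lia.
    assert (Hn : Pos.to_nat n <> O) by lia; revert Hn.
    generalize (Pos.to_nat n); clear n; intros k Hk.
    apply (is_derive_ext (fun t => / t ^ k)%R).
    + intro t; rewrite powerRZ_neg', <- pow_powerRZ; reflexivity.
    + assert (Hxk : (x ^ k <> 0)%R) by now apply pow_nonzero.
      replace (IZR (- Z.of_nat k) * powerRZ x (- Z.of_nat k - 1))%R
        with (- (INR k * 1 * x ^ pred k) / (x ^ k) ^ 2)%R.
      * apply is_derive_inv; [|exact Hxk].
        apply (is_derive_pow (fun t => t)).
        exact (is_derive_id (K := R_AbsRing) x).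
      * destruct k as [|k]; [lia|]; cbn [pred].
        replace (- Z.of_nat (S k) - 1)%Z
          with (- Z.of_nat (S (S k)))%Z by lia.
        rewrite powerRZ_neg', <- pow_powerRZ, opp_IZR, <- INR_IZR_INZ.
        cbn [pow] in *; field.
        split; [|exact Hx].
        intro H0; apply Hxk; rewrite H0; ring.
Qed.

Lemma update_at (p : point) (i : coord) (t : R) : update p i t i = t.
Proof. unfold update; destruct (coord_eq_dec i i); congruence. Qed.

Lemma update_other (p : point) (i j : coord) (t : R) :
  i <> j -> update p i t j = p j.
Proof. unfold update; destruct (coord_eq_dec i j); congruence. Qed.

Lemma is_pd_comp (i : coord) (f : R -> R) (p : point) (l : R) :
  is_derive f (p i) l -> is_pd i (fun q => RtoC (f (q i))) p l.
Proof.
  intro H; apply (is_pd_real i (fun q => f (q i))).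
  eapply is_derive_ext; [|exact H]; intro t; now rewrite update_at.
Qed.

Lemma is_pd_indep (i j : coord) (F : R -> C) (p : point) :
  i <> j -> is_pd i (fun q => F (q j)) p 0.
Proof.
  intro Hij; split.
  - apply (is_derive_ext (fun _ => Re (F (p j)))).
    + intro t; now rewrite update_other.
    + exact (is_derive_const (K := R_AbsRing) (V := R_NormedModule) _ _).
  - apply (is_derive_ext (fun _ => Im (F (p j)))).
    + intro t; now rewrite update_other.
    + exact (is_derive_const (K := R_AbsRing) (V := R_NormedModule) _ _).
Qed.

Lemma is_derive_Cexp_linear (z : C) (x : R) :
  is_derive (fun t => Re (Cexp (z * RtoC t))) x (Re (z * Cexp (z * x))) /\
  is_derive (fun t => Im (Cexp (z * RtoC t))) x (Im (z * Cexp (z * x))).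
Proof.
  destruct z as [u v]; unfold Cexp, Re, Im; cbn.
  split; auto_derive; trivial; unfold Rminus; ring.
Qed.

Lemma is_pd_h_pow (s : sign_choice) (n : Z) (p : point) :
  is_pd cx (fun q => h_pow s n (q cx)) p
    (RtoC (IZR n) * roll_rate s * h_pow s n (p cx)).
Proof.
  destruct (is_derive_Cexp_linear (IZR n * roll_rate s) (p cx)) as [Hr Hi].
  unfold h_pow; rewrite Cmult_assoc.
  split; (eapply is_derive_ext; [|eassumption]); intro t;
    cbv beta; rewrite update_at, Cmult_assoc; reflexivity.
Qed.

Lemma is_derive_cos_pow (n : nat) (x : R) :
  is_derive (fun t => cos t ^ n)%R x (- (INR n * (cos x ^ pred n * sin x)))%R.
Proof. auto_derive; trivial; ring. Qed.

Lemma is_derive_sin_pow (n : nat) (x : R) :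
  is_derive (fun t => sin t ^ n)%R x (INR n * (sin x ^ pred n * cos x))%R.
Proof. auto_derive; trivial; ring. Qed.

Lemma is_derive_sin_powerRZ (n : Z) (x : R) : sin x <> 0%R ->
  is_derive (fun t => powerRZ (sin t) n) x
    (IZR n * (powerRZ (sin x) (n - 1) * cos x))%R.
Proof.
  intro Hx.
  replace (IZR n * (powerRZ (sin x) (n - 1) * cos x))%R
    with (cos x * (IZR n * powerRZ (sin x) (n - 1)))%R by ring.
  apply (is_derive_comp (fun t => powerRZ t n) sin).
  - now apply is_derive_powerRZ.
  - auto_derive; trivial; ring.
Qed.

Lemma is_pd_mden (s : sign_choice) (i : coord) (m : mono) (p : point) :
  sin (p ctheta) <> 0%R -> is_pd i (mden s m) p (den s (mdiff i m) p).
Proof.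
  intro Hp.
  assert (Hcp := is_pd_comp cpsi _ p _ (is_derive_cos_pow (n_cp m) (p cpsi))).
  assert (Hsp := is_pd_comp cpsi _ p _ (is_derive_sin_pow (n_sp m) (p cpsi))).
  assert (Hct :=
    is_pd_comp ctheta _ p _ (is_derive_cos_pow (n_ct m) (p ctheta))).
  assert (Hst :=
    is_pd_comp ctheta _ p _ (is_derive_sin_powerRZ (n_st m) (p ctheta) Hp)).
  assert (Hh := is_pd_h_pow s (n_h m) p).
  set (l := den s (mdiff i m) p).
  (* Along a given coordinate each of the five factors either has its own derivative or is constant.
     With the five derivatives existentially bound, one use of the product rule serves all
     coordinates, and only the value of the result depends on [i]. *)
  assert (E : exists l1 l2 l3 l4 l5,
    is_pd i (fun q => RtoC (cos (q cpsi) ^ n_cp m)) p l1 /\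
    is_pd i (fun q => RtoC (sin (q cpsi) ^ n_sp m)) p l2 /\
    is_pd i (fun q => RtoC (cos (q ctheta) ^ n_ct m)) p l3 /\
    is_pd i (fun q => RtoC (powerRZ (sin (q ctheta)) (n_st m))) p l4 /\
    is_pd i (fun q => h_pow s (n_h m) (q cx)) p l5 /\
    ((((l1 * RtoC (sin (p cpsi) ^ n_sp m)
        + RtoC (cos (p cpsi) ^ n_cp m) * l2)
       * RtoC (cos (p ctheta) ^ n_ct m)
       + RtoC (cos (p cpsi) ^ n_cp m) * RtoC (sin (p cpsi) ^ n_sp m) * l3)
      * RtoC (powerRZ (sin (p ctheta)) (n_st m))
      + RtoC (cos (p cpsi) ^ n_cp m) * RtoC (sin (p cpsi) ^ n_sp m)
        * RtoC (cos (p ctheta) ^ n_ct m) * l4)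
     * h_pow s (n_h m) (p cx)
     + RtoC (cos (p cpsi) ^ n_cp m) * RtoC (sin (p cpsi) ^ n_sp m)
       * RtoC (cos (p ctheta) ^ n_ct m)
       * RtoC (powerRZ (sin (p ctheta)) (n_st m)) * l5 = l)).
  { assert (Hind : forall (j : coord) (F : R -> C), i <> j ->
      is_pd i (fun q => F (q j)) p 0) by (intros; now apply is_pd_indep).
    pose proof (Hind cpsi (fun x => RtoC (cos x ^ n_cp m))) as Icp.
    pose proof (Hind cpsi (fun x => RtoC (sin x ^ n_sp m))) as Isp.
    pose proof (Hind ctheta (fun x => RtoC (cos x ^ n_ct m))) as Ict.
    pose proof (Hind ctheta (fun x => RtoC (powerRZ (sin x) (n_st m)))) as Ist.
    pose proof (Hind cx (h_pow s (n_h m))) as Ih.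
    subst l; destruct i; do 5 eexists;
      (split; [first [exact Hcp | apply Icp; discriminate]|]);
      (split; [first [exact Hsp | apply Isp; discriminate]|]);
      (split; [first [exact Hct | apply Ict; discriminate]|]);
      (split; [first [exact Hst | apply Ist; discriminate]|]);
      (split; [first [exact Hh | apply Ih; discriminate]|]);
      cbn [mdiff]; rewrite ?den_cons; cbn [fst snd];
      unfold mden; cbn [n_cp n_sp n_ct n_st n_h];
      unfold cnat; change (inject_Z ?n, 0%Q) with (cint n);
      rewrite ?cden_opp, ?cden_cint, <- ?INR_IZR_INZ.
    - cbn [Nat.add pow]; rewrite ?RtoC_opp, ?RtoC_mult; rewrite ?den_nil; ring.
    - cbn [Nat.add pow]; rewrite powerRZ_add, powerRZ_1 by exact Hp.
      rewrite ?RtoC_opp, ?RtoC_mult; rewrite ?den_nil; ring.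
    - cbn [map mdiff fold_right app]; rewrite ?den_nil; ring.
    - unfold cden; cbn [fst snd]; rewrite RMicromega.Q2R_0.
      unfold Q2R, inject_Z; cbn [Qnum Qden]; rewrite Rinv_1, Rmult_1_r.
      rewrite ?den_nil; ring.
    - cbn [map mdiff fold_right app]; rewrite ?den_nil; ring. }
  destruct E as (l1 & l2 & l3 & l4 & l5 & H1 & H2 & H3 & H4 & H5 & <-).
  unfold mden; repeat apply is_pd_mult; assumption.
Qed.

Lemma is_pd_den (s : sign_choice) (i : coord) (P : poly) (p : point) :
  sin (p ctheta) <> 0%R -> is_pd i (den s P) p (den s (pdiff i P) p).
Proof.
  intro Hp; unfold pdiff; induction P as [|t P IH]; cbn [fold_right].
  - apply is_pd_const.
  - rewrite den_padd, den_reduce by exact Hp.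
    apply (is_pd_plus i (fun q => cden s (fst t) * mden s (snd t) q));
      [|exact IH].
    replace (den s _ p) with
      (0 * mden s (snd t) p + cden s (fst t) * den s (mdiff i (snd t)) p).
    + apply (is_pd_mult i (fun _ => cden s (fst t))).
      * apply is_pd_const.
      * now apply is_pd_mden.
    + induction (mdiff i (snd t)) as [|t' D IHD]; cbn [map].
      * cbn [map mdiff fold_right app]; rewrite ?den_nil; ring.
      * rewrite !den_cons; cbn [fst snd]; rewrite <- IHD, cden_mul; ring.
Qed.

Lemma is_derive_continuous (f : R -> R) (x l : R) :
  is_derive f x l -> continuous f x.
Proof.
  intro H; exact (ex_derive_continuous (K := R_AbsRing) (V := R_NormedModule)
    f x (ex_intro _ l H)).
Qed.

Lemma continuous_den (s : sign_choice) (P : poly) (p : point) :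
  sin (p ctheta) <> 0%R -> continuous (den s P) p.
Proof.
  intro Hp.
  assert (Hreal : forall (i : coord) (f : R -> R) (l : R),
    is_derive f (p i) l -> continuous (fun q : point => RtoC (f (q i))) p).
  { intros i f l Hf; apply continuous_RtoC.
    apply (continuous_comp (fun q : point => q i) f).
    - apply continuous_proj.
    - now apply (is_derive_continuous f _ l). }
  induction P as [|t P IH].
  - apply continuous_const.
  - apply (continuous_Cplus (fun q => cden s (fst t) * mden s (snd t) q));
      [|exact IH].
    apply continuous_Cmult; [apply continuous_const|].
    unfold mden; apply continuous_Cmult;
      [apply continuous_Cmult;
         [apply continuous_Cmult; [apply continuous_Cmult|]|]|].
    + eapply (Hreal cpsi (fun x => cos x ^ _)%R), is_derive_cos_pow.
    + eapply (Hreal cpsi (fun x => sin x ^ _)%R), is_derive_sin_pow.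
    + eapply (Hreal ctheta (fun x => cos x ^ _)%R), is_derive_cos_pow.
    + eapply (Hreal ctheta (fun x => powerRZ (sin x) _)%R).
      now apply is_derive_sin_powerRZ.
    + destruct (is_derive_Cexp_linear (IZR (n_h (snd t)) * roll_rate s) (p cx))
        as [Hr Hi].
      apply (continuous_ext
        (fun q : point => Cexp (IZR (n_h (snd t)) * roll_rate s * q cx))).
      { intro q; unfold h_pow; now rewrite Cmult_assoc. }
      apply continuous_C.
      * exact (continuous_comp (fun q : point => q cx) _ p
          (continuous_proj cx p) (is_derive_continuous _ _ _ Hr)).
      * exact (continuous_comp (fun q : point => q cx) _ p
          (continuous_proj cx p) (is_derive_continuous _ _ _ Hi)).
Qed.

(** The ring is stable under partial derivatives, so continuity of its elements already gives all
    orders. The induction on the order is uniform in the polynomial because it passes from [P] to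
    [pdiff i P]. *)
Lemma smooth_den (V : point -> Prop) (s : sign_choice) (f : point -> C)
  (P : poly) :
  open V -> (forall p, V p -> sin (p ctheta) <> 0%R) ->
  (forall p, V p -> f p = den s P p) -> smooth V f.
Proof.
  intros HV Hsin Hf k.
  apply (Ck_ext V HV k (den s P)); [intros; symmetry; auto|].
  clear f Hf; revert P; induction k as [|k IH]; intro P; cbn.
  - intros p Hp; apply continuous_den; auto.
  - split; [apply IH|]; intro i; split.
    + intros p Hp; eapply is_pd_ex, is_pd_den; auto.
    + apply (Ck_ext V HV k (den s (pdiff i P))); [|apply IH].
      intros p Hp; symmetry; apply is_pd_unique, is_pd_den; auto.
Qed.

Lemma pd_den (V : point -> Prop) (s : sign_choice) (f : point -> C)
  (P : poly) (i : coord) (p : point) :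
  open V -> (forall p, V p -> sin (p ctheta) <> 0%R) ->
  (forall p, V p -> f p = den s P p) -> V p ->
  pd i f p = den s (pdiff i P) p.
Proof.
  intros HV Hsin Hf Hp; apply is_pd_unique.
  apply (is_pd_ext V i (den s P)); auto using is_pd_den.
  intros; symmetry; auto.
Qed.

(** * Curvature of metrics with trigonometric Laurent coefficients *)

(* Under call by value, [memo F] computes the five values of [F] only once. *)
Definition memo {T : Type} (F : coord -> T) : coord -> T :=
  let a := F cpsi in let b := F ctheta in let c := F cphi in
  let d := F cx in let e := F cq in
  fun i => match i with
           | cpsi => a | ctheta => b | cphi => c | cx => d | cq => e
           end.

Definition memo2 {T : Type} (F : coord -> coord -> T) : coord -> coord -> T :=
  memo (fun i => memo (F i)).
Definition memo3 {T : Type} (F : coord -> coord -> coord -> T) :=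
  memo (fun i => memo2 (F i)).
Definition memo4 {T : Type} (F : coord -> coord -> coord -> coord -> T) :=
  memo (fun i => memo3 (F i)).

Lemma memo_eq {T : Type} (F : coord -> T) (i : coord) : memo F i = F i.
Proof. destruct i; reflexivity. Qed.

Lemma memo2_eq {T : Type} (F : coord -> coord -> T) (i j : coord) :
  memo2 F i j = F i j.
Proof. unfold memo2; now rewrite !memo_eq. Qed.

Lemma memo3_eq {T : Type} (F : coord -> coord -> coord -> T)
  (i j k : coord) : memo3 F i j k = F i j k.
Proof. unfold memo3; now rewrite memo_eq, memo2_eq. Qed.

Lemma memo4_eq {T : Type} (F : coord -> coord -> coord -> coord -> T)
  (i j k l : coord) : memo4 F i j k l = F i j k l.
Proof. unfold memo4; now rewrite memo_eq, memo3_eq. Qed.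

Definition all_coord (b : coord -> bool) : bool :=
  b cpsi && b ctheta && b cphi && b cx && b cq.

Lemma all_coord_forall (b : coord -> bool) :
  all_coord b = true -> forall i, b i = true.
Proof.
  unfold all_coord; rewrite !andb_true_iff; intros H i; destruct i; tauto.
Qed.

Definition psumc (F : coord -> poly) : poly :=
  padd (padd (padd (padd (F cpsi) (F ctheta)) (F cphi)) (F cx)) (F cq).

(** The setting in which the ring can be used: on such a set sin theta is invertible and
    differentiation is local. *)
Definition regular (V : point -> Prop) : Prop :=
  open V /\ forall p, V p -> sin (p ctheta) <> 0%R.

Definition represents (V : point -> Prop) (s : sign_choice) (P : poly)
  (f : point -> C) : Prop := forall p, V p -> f p = den s P p.

Lemma den_psumc (s : sign_choice) (F : coord -> poly) (p : point) :
  den s (psumc F) p = sumc (fun i => den s (F i) p).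
Proof. unfold psumc; rewrite !den_padd; reflexivity. Qed.

Lemma sumc_ext (F G : coord -> C) :
  (forall i, F i = G i) -> sumc F = sumc G.
Proof. intro H; unfold sumc; now rewrite !H. Qed.

Lemma represents_pd (V : point -> Prop) (s : sign_choice) (P : poly)
  (f : point -> C) (i : coord) :
  regular V -> represents V s P f -> represents V s (pdiff i P) (pd i f).
Proof. intros [HV Hsin] Hf p Hp; now apply (pd_den V). Qed.

Lemma represents_smooth (V : point -> Prop) (s : sign_choice) (P : poly)
  (f : point -> C) : regular V -> represents V s P f -> smooth V f.
Proof. intros [HV Hsin] Hf; now apply (smooth_den V s f P). Qed.

Definition pquot (n : Z) (d : positive) : poly := pconst (Qmake n d, 0%Q).

Lemma den_pquot (s : sign_choice) (n : Z) (d : positive) (p : point) :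
  den s (pquot n d) p = RtoC (IZR n) / RtoC (IZR (Zpos d)).
Proof.
  unfold pquot; rewrite den_pconst; unfold cden; cbn [fst snd].
  rewrite RMicromega.Q2R_0; unfold Q2R; cbn [Qnum Qden].
  rewrite RtoC_mult, RtoC_inv by (now apply eq_IZR_contrapositive).
  unfold Cdiv; ring.
Qed.

Definition ptensor2 := coord -> coord -> poly.

Definition christoffel_poly (g gi : ptensor2) (k i j : coord) : poly :=
  pmul (pquot 1 2) (psumc (fun l => pmul (gi k l)
    (psub (padd (pdiff i (g j l)) (pdiff j (g i l))) (pdiff l (g i j))))).

Definition riemann_poly (G : coord -> coord -> coord -> poly)
  (i j k l : coord) : poly :=
  padd (psub (pdiff i (G l j k)) (pdiff j (G l i k)))
    (psumc (fun m => psub (pmul (G l i m) (G m j k))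
                          (pmul (G l j m) (G m i k)))).

Definition ricci_poly (Rm : coord -> coord -> coord -> coord -> poly)
  (j k : coord) : poly := psumc (fun i => Rm i j k i).

Definition scalar_poly (gi Rc : ptensor2) : poly :=
  psumc (fun j => psumc (fun k => pmul (gi j k) (Rc j k))).

Definition weyl_poly (g : ptensor2)
  (Rm : coord -> coord -> coord -> coord -> poly) (Rc : ptensor2) (S : poly)
  (i j k l : coord) : poly :=
  padd
    (psub (psumc (fun m => pmul (Rm i j k m) (g m l)))
       (pmul (pquot 1 3)
          (psub (padd (psub (pmul (g i l) (Rc j k)) (pmul (g i k) (Rc j l)))
                      (pmul (g j k) (Rc i l)))
                (pmul (g j l) (Rc i k)))))
    (pmul (pmul S (pquot 1 12))
       (psub (pmul (g i l) (g j k)) (pmul (g i k) (g j l)))).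

Definition riemann_table (g gi : ptensor2) :
  coord -> coord -> coord -> coord -> poly :=
  let G := memo3 (christoffel_poly g gi) in memo4 (riemann_poly G).

(** The inverse is supplied as a table and verified by multiplication, so its origin does not matter
    and no elimination over the ring is performed. The same pass tests the symmetry of [g]. *)
Definition inverse_check (g gi : ptensor2) : bool :=
  all_coord (fun i => all_coord (fun j =>
    peqb (g i j) (g j i) &&
    peqb (psumc (fun k => pmul (g i k) (gi k j)))
         (if coord_eq_dec i j then pquot 1 1 else nil))).

Definition flat_check (g gi : ptensor2) : bool :=
  let g := memo2 g in let gi := memo2 gi in
  let Rm := riemann_table g gi in
  inverse_check g gi &&
  all_coord (fun i => all_coord (fun j => all_coord (fun k =>
    all_coord (fun l => peqb (Rm i j k l) nil)))).

Definition weyl_check (g gi : ptensor2) : bool :=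
  let g := memo2 g in let gi := memo2 gi in
  let Rm := riemann_table g gi in
  let Rc := memo2 (ricci_poly Rm) in
  let S := scalar_poly gi Rc in
  inverse_check g gi &&
  all_coord (fun i => all_coord (fun j => all_coord (fun k =>
    all_coord (fun l => peqb (weyl_poly g Rm Rc S i j k l) nil)))).

Definition represents_tensor (V : point -> Prop) (s : sign_choice)
  (gP : ptensor2) (g : tensor2) : Prop :=
  forall i j, represents V s (gP i j) (fun p => g p i j).

Lemma represents_memo2 (V : point -> Prop) (s : sign_choice)
  (gP : ptensor2) (g : tensor2) :
  represents_tensor V s gP g -> represents_tensor V s (memo2 gP) g.
Proof. intros H i j; rewrite memo2_eq; apply H. Qed.

Lemma inverse_check_metric (V : point -> Prop) (s : sign_choice)
  (gP giP : ptensor2) (g gi : tensor2) :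
  regular V -> represents_tensor V s gP g -> represents_tensor V s giP gi ->
  inverse_check gP giP = true -> metric_with_inverse V g gi.
Proof.
  intros HV Hg Hgi Hc.
  assert (H : forall i j, peqb (gP i j) (gP j i) = true /\
    peqb (psumc (fun k => pmul (gP i k) (giP k j)))
         (if coord_eq_dec i j then pquot 1 1 else nil) = true).
  { intros i j; apply andb_true_iff.
    exact (all_coord_forall _ (all_coord_forall _ Hc i) j). }
  split; [|split].
  - intros i j; exact (represents_smooth V s (gP i j) _ HV (Hg i j)).
  - intros p Hp i j; rewrite (Hg i j p Hp), (Hg j i p Hp).
    apply peqb_den, H.
  - intros p Hp i j; transitivity
      (den s (psumc (fun k => pmul (gP i k) (giP k j))) p).
    + rewrite den_psumc; apply sumc_ext; intro k.
      rewrite den_pmul by (apply HV, Hp).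
      now rewrite (Hg i k p Hp), (Hgi k j p Hp).
    + rewrite (peqb_den s _ _ p (proj2 (H i j))); unfold delta.
      destruct (coord_eq_dec i j); [rewrite den_pquot; field | reflexivity].
Qed.

Lemma represents_christoffel (V : point -> Prop) (s : sign_choice)
  (gP giP : ptensor2) (g gi : tensor2) (k i j : coord) :
  regular V -> represents_tensor V s gP g -> represents_tensor V s giP gi ->
  represents V s (christoffel_poly gP giP k i j) (christoffel g gi k i j).
Proof.
  intros HV Hg Hgi p Hp; pose proof (proj2 HV p Hp) as Hs.
  unfold christoffel, christoffel_poly.
  rewrite den_pmul, den_pquot, den_psumc by exact Hs.
  replace (1 / 2) with (/ 2) by field; f_equal; apply sumc_ext; intro l.
  rewrite den_pmul, den_psub, den_padd by exact Hs.
  rewrite (Hgi k l p Hp).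
  now rewrite (represents_pd V s _ _ i HV (Hg j l) p Hp),
    (represents_pd V s _ _ j HV (Hg i l) p Hp),
    (represents_pd V s _ _ l HV (Hg i j) p Hp).
Qed.

Lemma represents_riemann (V : point -> Prop) (s : sign_choice)
  (gP giP : ptensor2) (g gi : tensor2) (i j k l : coord) :
  regular V -> represents_tensor V s gP g -> represents_tensor V s giP gi ->
  represents V s (riemann_table gP giP i j k l) (riemann g gi i j k l).
Proof.
  intros HV Hg Hgi; unfold riemann_table; rewrite memo4_eq.
  assert (HG : forall k i j, represents V s
    (memo3 (christoffel_poly gP giP) k i j) (christoffel g gi k i j)).
  { intros; rewrite memo3_eq; now apply represents_christoffel. }
  (* What follows holds for any table that represents the Christoffel symbols. Abstracting it keeps
     their polynomials from being unfolded. *)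
  revert HG; generalize (memo3 (christoffel_poly gP giP)); intros G HG p Hp.
  pose proof (proj2 HV p Hp) as Hs.
  unfold riemann, riemann_poly.
  rewrite den_padd, den_psub, den_psumc.
  rewrite (represents_pd V s _ _ i HV (HG l j k) p Hp),
    (represents_pd V s _ _ j HV (HG l i k) p Hp).
  f_equal; apply sumc_ext; intro m.
  rewrite den_psub, !den_pmul by exact Hs.
  now rewrite (HG l i m p Hp), (HG m j k p Hp), (HG l j m p Hp),
    (HG m i k p Hp).
Qed.

Lemma flat_check_flat (V : point -> Prop) (s : sign_choice)
  (gP giP : ptensor2) (g : tensor2) :
  regular V -> represents_tensor V s gP g -> flat_check gP giP = true ->
  flat V g.
Proof.
  intros HV Hg [Hc H]%andb_true_iff.
  apply represents_memo2 in Hg.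
  assert (Hgi : represents_tensor V s (memo2 giP)
    (fun p i j => den s (memo2 giP i j) p)) by (intros i j p _; reflexivity).
  exists (fun p i j => den s (memo2 giP i j) p); split.
  - exact (inverse_check_metric V s _ _ _ _ HV Hg Hgi Hc).
  - intros p Hp i j k l.
    rewrite (represents_riemann V s _ _ _ _ i j k l HV Hg Hgi p Hp).
    apply (peqb_den s _ nil p).
    exact (all_coord_forall _ (all_coord_forall _ (all_coord_forall _
      (all_coord_forall _ H i) j) k) l).
Qed.

Lemma weyl_check_weyl_vanishes (V : point -> Prop) (s : sign_choice)
  (gP giP : ptensor2) (g : tensor2) :
  regular V -> represents_tensor V s gP g -> weyl_check gP giP = true ->
  weyl_vanishes V g.
Proof.
  intros HV Hg [Hc H]%andb_true_iff.
  apply represents_memo2 in Hg.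
  assert (Hgi : represents_tensor V s (memo2 giP)
    (fun p i j => den s (memo2 giP i j) p)) by (intros i j p _; reflexivity).
  exists (fun p i j => den s (memo2 giP i j) p); split.
  - exact (inverse_check_metric V s _ _ _ _ HV Hg Hgi Hc).
  - intros p Hp i j k l; pose proof (proj2 HV p Hp) as Hs.
    pose proof (all_coord_forall _ (all_coord_forall _ (all_coord_forall _
      (all_coord_forall _ H i) j) k) l) as W.
    clear Hc H; cbv beta in W; apply (peqb_den s _ nil p) in W.
    set (h := fun p i j => den s (memo2 giP i j) p) in *.
    assert (HR : forall i j k l, represents V s
      (riemann_table (memo2 gP) (memo2 giP) i j k l) (riemann g h i j k l))
      by (intros; now apply represents_riemann).
    revert HR W; generalize (riemann_table (memo2 gP) (memo2 giP)).
    intros Rm HR W.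
    assert (HRc : represents_tensor V s (memo2 (ricci_poly Rm))
      (fun p j k => ricci g h j k p)).
    { intros j' k' q Hq; rewrite memo2_eq; unfold ricci, ricci_poly.
      rewrite den_psumc; apply sumc_ext; intro; now apply HR. }
    revert HRc W; generalize (memo2 (ricci_poly Rm)); intros Rc HRc W.
    assert (HS : den s (scalar_poly (memo2 giP) Rc) p = scalar_curv g h p).
    { unfold scalar_poly, scalar_curv; rewrite den_psumc.
      apply sumc_ext; intro j'; rewrite den_psumc.
      apply sumc_ext; intro k'; rewrite den_pmul by exact Hs.
      now rewrite <- (HRc j' k' p Hp), <- (Hgi j' k' p Hp). }
    (* The 0 of the goal is replaced by the value of the Weyl polynomial. Both sides then become the
       same expression in the metric, its curvature tensors and the scalar curvature. *)
    rewrite den_nil in W; rewrite <- W; clear W.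
    unfold weyl, weyl_poly, riemann_low.
    rewrite !den_padd, !den_psub, !den_pmul, !den_pquot, den_psumc
      by exact Hs.
    repeat first [rewrite den_padd | rewrite den_psub
      | rewrite den_pmul by exact Hs].
    rewrite HS.
    rewrite <- !(Hg _ _ p Hp), <- !(HRc _ _ p Hp).
    rewrite (sumc_ext (fun m => den s (pmul (Rm i j k m) (memo2 gP m l)) p)
      (fun m => riemann g h i j k m p * g p m l)).
    + field.
    + intro m; rewrite den_pmul by exact Hs.
      now rewrite (HR i j k m p Hp), (Hg m l p Hp).
Qed.

(** * The forms and vector fields of the theorem *)

Definition pform := coord -> poly.

Definition pvar (a b c : nat) (d e : Z) : poly :=
  ((1%Q, 0%Q), Mono a b c d e) :: nil.
Definition p_cp : poly := pvar 1 0 0 0 0.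
Definition p_sp : poly := pvar 0 1 0 0 0.
Definition p_ct : poly := pvar 0 0 1 0 0.
Definition p_st : poly := pvar 0 0 0 1 0.
Definition p_st_inv : poly := pvar 0 0 0 (-1) 0.
Definition p_h (n : Z) : poly := pvar 0 0 0 0 n.
Definition p_rate : poly := pconst (0%Q, 1%Q).
Definition p_delta (i j : coord) : poly :=
  if coord_eq_dec i j then pquot 1 1 else nil.

Lemma den_pvar (s : sign_choice) (m : mono) (p : point) :
  den s (((1%Q, 0%Q), m) :: nil) p = mden s m p.
Proof.
  rewrite den_cons, den_nil; cbn [fst snd].
  change (1%Q, 0%Q) with (cint 1); rewrite cden_cint; ring.
Qed.

Lemma h_pow_0 (s : sign_choice) (x : R) : h_pow s 0 x = 1.
Proof.
  unfold h_pow; replace (0 * (roll_rate s * x)) with (RtoC 0) by ring.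
  apply Cexp_0.
Qed.

Lemma h_pow_1 (s : sign_choice) (x : R) : h_pow s 1 x = h_roll s x.
Proof.
  unfold h_pow, h_roll, roll_rate; f_equal; ring.
Qed.

Ltac den_atom :=
  intros; unfold p_cp, p_sp, p_ct, p_st, p_st_inv, p_h, pvar;
  rewrite den_pvar; unfold mden; cbn [n_cp n_sp n_ct n_st n_h];
  rewrite ?h_pow_0, ?powerRZ_1, ?pow_1, ?pow_O; cbn [powerRZ]; ring.

Lemma den_cp (s : sign_choice) (p : point) :
  den s p_cp p = RtoC (cos (p cpsi)).
Proof. den_atom. Qed.
Lemma den_sp (s : sign_choice) (p : point) :
  den s p_sp p = RtoC (sin (p cpsi)).
Proof. den_atom. Qed.
Lemma den_ct (s : sign_choice) (p : point) :
  den s p_ct p = RtoC (cos (p ctheta)).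
Proof. den_atom. Qed.
Lemma den_st (s : sign_choice) (p : point) :
  den s p_st p = RtoC (sin (p ctheta)).
Proof. den_atom. Qed.
Lemma den_h (s : sign_choice) (n : Z) (p : point) :
  den s (p_h n) p = h_pow s n (p cx).
Proof. den_atom. Qed.
Lemma den_st_inv (s : sign_choice) (p : point) : sin (p ctheta) <> 0%R ->
  den s p_st_inv p = / RtoC (sin (p ctheta)).
Proof.
  intro Hs; unfold p_st_inv, pvar; rewrite den_pvar; unfold mden.
  cbn [n_cp n_sp n_ct n_st n_h pow]; rewrite h_pow_0.
  change (powerRZ ?x (-1)) with (/ (x * 1))%R.
  rewrite Rmult_1_r, RtoC_inv by exact Hs; ring.
Qed.
Lemma den_rate (s : sign_choice) (p : point) :
  den s p_rate p = roll_rate s.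
Proof.
  unfold p_rate; rewrite den_pconst; unfold cden; cbn [fst snd].
  rewrite RMicromega.Q2R_0, RMicromega.Q2R_1; ring.
Qed.
Lemma den_delta (s : sign_choice) (i j : coord) (p : point) :
  den s (p_delta i j) p = delta i j.
Proof.
  unfold p_delta, delta; destruct (coord_eq_dec i j);
    [rewrite den_pquot; field | reflexivity].
Qed.

Lemma pm_rate (s : sign_choice) : pm s * (Ci / 3) = - roll_rate s.
Proof. unfold roll_rate; destruct s; cbn [pm mp]; rewrite ?RtoC_opp; ring. Qed.

Lemma RtoC_cot (t : R) : sin t <> 0%R ->
  RtoC (cot t) = RtoC (cos t) * / RtoC (sin t).
Proof. intro H; unfold cot; now rewrite RtoC_div. Qed.

Ltac den_expand Hs :=
  repeat first
    [ rewrite den_padd | rewrite den_psub | rewrite den_popp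
    | rewrite den_pmul by exact Hs | rewrite den_cp | rewrite den_sp
    | rewrite den_ct | rewrite den_st | rewrite den_st_inv by exact Hs
    | rewrite den_h | rewrite den_rate | rewrite den_delta
    | rewrite den_pquot | rewrite h_pow_1 ].

(** * Polynomial components of the forms and vector fields *)

Definition psigma_1 : pform := fun i =>
  psub (pmul p_sp (p_delta ctheta i))
       (pmul (pmul p_cp p_st) (p_delta cphi i)).
Definition psigma_2 : pform := fun i =>
  padd (pmul p_cp (p_delta ctheta i))
       (pmul (pmul p_sp p_st) (p_delta cphi i)).
Definition psigma_3 : pform := fun i =>
  psub (popp (p_delta cpsi i)) (pmul p_ct (p_delta cphi i)).
Definition pE_1 : pform := fun i =>
  padd (pmul p_sp (p_delta ctheta i))
       (pmul p_cp (psub (pmul (pmul p_ct p_st_inv) (p_delta cpsi i))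
                        (pmul p_st_inv (p_delta cphi i)))).
Definition pE_2 : pform := fun i =>
  psub (pmul p_cp (p_delta ctheta i))
       (pmul p_sp (psub (pmul (pmul p_ct p_st_inv) (p_delta cpsi i))
                        (pmul p_st_inv (p_delta cphi i)))).
Definition pE_3 : pform := fun i => popp (p_delta cpsi i).
Definition pdx : pform := fun i => p_delta cx i.
Definition phdq : pform := fun i => pmul (p_h 1) (p_delta cq i).

Definition pX_1 : pform := fun i => padd (pdx i) (pE_2 i).
Definition pX_2 : pform := fun i =>
  padd (padd (p_delta cq i) (pmul (p_h 1) (pE_1 i)))
       (pmul (pmul p_rate (p_h 1)) (pE_3 i)).

Definition po_1 : pform := fun i => psub (psigma_1 i) (phdq i).
Definition po_2 : pform := fun i => psub (psigma_2 i) (pdx i).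
Definition po_3 : pform := fun i => psub (psigma_3 i) (pmul p_rate (phdq i)).
Definition po_4 : pform := fun i => popp (pdx i).
Definition po_5 : pform := phdq.
Definition pot_1 : pform := fun i => padd (psigma_1 i) (phdq i).
Definition pot_2 : pform := fun i => padd (psigma_2 i) (pdx i).

Definition pomega_1 : pform := fun i =>
  psub (psub (p_delta ctheta i) (pmul p_cp (pdx i))) (pmul p_sp (phdq i)).
Definition pomega_2 : pform := fun i =>
  psub (padd (popp (pmul p_st (p_delta cphi i))) (pmul p_sp (pdx i)))
       (pmul p_cp (phdq i)).
(** The quotients h_x/h and f_theta/f cancel against the factors h of [chi_4] and f of [chi_2]. What
    remains is d psi + a h dq + cos theta d phi, that is, -o_3. *)
Definition pomega_3 : pform := fun i =>
  padd (padd (p_delta cpsi i) (pmul p_rate (phdq i)))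
       (pmul p_ct (p_delta cphi i)).
Definition pomega_4 : pform := fun i =>
  psub (pmul p_sp (pdx i)) (pmul p_cp (phdq i)).
Definition pomega_5 : pform := fun i =>
  padd (pmul p_cp (pdx i)) (pmul p_sp (phdq i)).

(** * Agreement of these components with the given forms and fields *)

Definition represents_at (s : sign_choice) (p : point) (P : pform)
  (a : point -> coord -> C) : Prop := forall i, a p i = den s (P i) p.

Lemma den_sigma_1 (s : sign_choice) (p : point)
  (Hs : sin (p ctheta) <> 0%R) : represents_at s p psigma_1 sigma_1.
Proof. intro i; unfold psigma_1, sigma_1; den_expand Hs; reflexivity. Qed.
Lemma den_sigma_2 (s : sign_choice) (p : point)
  (Hs : sin (p ctheta) <> 0%R) : represents_at s p psigma_2 sigma_2.
Proof. intro i; unfold psigma_2, sigma_2; den_expand Hs; reflexivity. Qed.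
Lemma den_sigma_3 (s : sign_choice) (p : point)
  (Hs : sin (p ctheta) <> 0%R) : represents_at s p psigma_3 sigma_3.
Proof. intro i; unfold psigma_3, sigma_3; den_expand Hs; reflexivity. Qed.
Lemma den_E_1 (s : sign_choice) (p : point)
  (Hs : sin (p ctheta) <> 0%R) : represents_at s p pE_1 E_1.
Proof.
  intro i; unfold pE_1, E_1; den_expand Hs; rewrite RtoC_cot by exact Hs.
  reflexivity.
Qed.
Lemma den_E_2 (s : sign_choice) (p : point)
  (Hs : sin (p ctheta) <> 0%R) : represents_at s p pE_2 E_2.
Proof.
  intro i; unfold pE_2, E_2; den_expand Hs; rewrite RtoC_cot by exact Hs.
  reflexivity.
Qed.
Lemma den_E_3 (s : sign_choice) (p : point) : represents_at s p pE_3 E_3.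
Proof. intro i; unfold pE_3; rewrite den_popp, den_delta; reflexivity. Qed.

Lemma den_X_1 (s : sign_choice) (p : point)
  (Hs : sin (p ctheta) <> 0%R) : represents_at s p pX_1 X_1.
Proof.
  intro i; unfold pX_1, X_1, pdx; den_expand Hs; now rewrite (den_E_2 s p Hs).
Qed.
Lemma den_X_2 (s : sign_choice) (p : point)
  (Hs : sin (p ctheta) <> 0%R) : represents_at s p pX_2 (X_2 s).
Proof.
  intro i; unfold pX_2, X_2; den_expand Hs.
  now rewrite (den_E_1 s p Hs), (den_E_3 s p).
Qed.
Lemma den_o_1 (s : sign_choice) (p : point)
  (Hs : sin (p ctheta) <> 0%R) : represents_at s p po_1 (o_1 s).
Proof.
  intro i; unfold po_1, o_1, phdq; den_expand Hs.
  now rewrite (den_sigma_1 s p Hs).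
Qed.
Lemma den_o_2 (s : sign_choice) (p : point)
  (Hs : sin (p ctheta) <> 0%R) : represents_at s p po_2 o_2.
Proof.
  intro i; unfold po_2, o_2, pdx; den_expand Hs.
  now rewrite (den_sigma_2 s p Hs).
Qed.
Lemma den_o_3 (s : sign_choice) (p : point)
  (Hs : sin (p ctheta) <> 0%R) : represents_at s p po_3 (o_3 s).
Proof.
  intro i; unfold po_3, o_3, phdq; den_expand Hs.
  rewrite (den_sigma_3 s p Hs), pm_rate; ring.
Qed.
Lemma den_o_4 (s : sign_choice) (p : point) : represents_at s p po_4 o_4.
Proof.
  intro i; unfold po_4, pdx; rewrite den_popp, den_delta; reflexivity.
Qed.
Lemma den_o_5 (s : sign_choice) (p : point)
  (Hs : sin (p ctheta) <> 0%R) : represents_at s p po_5 (o_5 s).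
Proof. intro i; unfold po_5, o_5, phdq; den_expand Hs; reflexivity. Qed.
Lemma den_ot_1 (s : sign_choice) (p : point)
  (Hs : sin (p ctheta) <> 0%R) : represents_at s p pot_1 (ot_1 s).
Proof.
  intro i; unfold pot_1, ot_1, phdq; den_expand Hs.
  now rewrite (den_sigma_1 s p Hs).
Qed.
Lemma den_ot_2 (s : sign_choice) (p : point)
  (Hs : sin (p ctheta) <> 0%R) : represents_at s p pot_2 ot_2.
Proof.
  intro i; unfold pot_2, ot_2, pdx; den_expand Hs.
  now rewrite (den_sigma_2 s p Hs).
Qed.

Lemma den_omega_1 (s : sign_choice) (p : point)
  (Hs : sin (p ctheta) <> 0%R) : represents_at s p pomega_1 (omega_1 s).
Proof.
  intro i; unfold pomega_1, omega_1, chi_1, chi_3, chi_4, pdx, phdq.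
  den_expand Hs; reflexivity.
Qed.
Lemma den_omega_2 (s : sign_choice) (p : point)
  (Hs : sin (p ctheta) <> 0%R) : represents_at s p pomega_2 (omega_2 s).
Proof.
  intro i; unfold pomega_2, omega_2, chi_2, chi_3, chi_4, f_roll, pdx, phdq.
  den_expand Hs; rewrite RtoC_opp; ring.
Qed.
Lemma den_omega_4 (s : sign_choice) (p : point)
  (Hs : sin (p ctheta) <> 0%R) : represents_at s p pomega_4 (omega_4 s).
Proof.
  intro i; unfold pomega_4, omega_4, chi_3, chi_4, pdx, phdq.
  den_expand Hs; reflexivity.
Qed.
Lemma den_omega_5 (s : sign_choice) (p : point)
  (Hs : sin (p ctheta) <> 0%R) : represents_at s p pomega_5 (omega_5 s).
Proof.
  intro i; unfold pomega_5, omega_5, chi_3, chi_4, pdx, phdq.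
  den_expand Hs; reflexivity.
Qed.

Lemma h_pow_inv (s : sign_choice) (n : Z) (x : R) : 
  h_pow s n x * h_pow s (- n) x = 1.
Proof.
  unfold h_pow; rewrite <- Cexp_plus, <- Cexp_0, opp_IZR, RtoC_opp.
  f_equal; ring.
Qed.

Lemma h_pow_neq_0 (s : sign_choice) (n : Z) (x : R) : h_pow s n x <> 0.
Proof.
  intro H; pose proof (h_pow_inv s n x) as E; rewrite H in E.
  apply C1_nz; rewrite <- E; ring.
Qed.

Lemma h_roll_neq_0 (s : sign_choice) (x : R) : h_roll s x <> 0.
Proof. rewrite <- h_pow_1; apply h_pow_neq_0. Qed.

Lemma Cderiv_h_roll (s : sign_choice) (x : R) :
  Cderiv (h_roll s) x = roll_rate s * h_roll s x.
Proof.
  destruct (is_derive_Cexp_linear (roll_rate s) x) as [Hr Hi].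
  apply C_eq; unfold Cderiv; cbn [Re Im fst snd].
  - exact (is_derive_unique _ _ _ Hr).
  - exact (is_derive_unique _ _ _ Hi).
Qed.

Lemma den_omega_3 (s : sign_choice) (p : point)
  (Hs : sin (p ctheta) <> 0%R) : represents_at s p pomega_3 (omega_3 s).
Proof.
  intro i; unfold pomega_3, omega_3, chi_2, chi_4, phdq.
  rewrite Cderiv_h_roll.
  replace (Derive f_roll (p ctheta)) with (- cos (p ctheta))%R.
  - unfold f_roll; den_expand Hs; rewrite !RtoC_opp.
    field; split; [|apply h_roll_neq_0].
    intro H; apply Hs; now apply RtoC_inj.
  - symmetry; apply is_derive_unique; unfold f_roll.
    auto_derive; trivial; ring.
Qed.

(** * The two expressions of the metric *)

Definition psprod (a b : pform) : ptensor2 := fun i j =>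
  pmul (pquot 1 2) (padd (pmul (a i) (b j)) (pmul (a j) (b i))).

Lemma den_psprod (s : sign_choice) (p : point) (P Q : pform) (a b : form)
  (i j : coord) : sin (p ctheta) <> 0%R ->
  represents_at s p P a -> represents_at s p Q b ->
  sprod a b p i j = den s (psprod P Q i j) p.
Proof.
  intros Hs Ha Hb; unfold sprod, psprod; den_expand Hs.
  rewrite <- !Ha, <- !Hb; field.
Qed.

Definition pg_o : ptensor2 := fun i j =>
  padd (padd (padd (padd
    (popp (pmul (pquot 2 1)
      (padd (psprod po_4 po_4 i j) (psprod po_5 po_5 i j))))
    (pmul (pquot 1 2) (psprod pot_1 pot_1 i j)))
    (pmul (pquot 1 2) (psprod pot_2 pot_2 i j)))
    (pmul (pquot 1 2) (psprod po_3 po_3 i j)))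
    (padd (padd (psprod po_1 po_1 i j) (psprod po_2 po_2 i j))
          (psprod po_3 po_3 i j)).

Definition pg_rolling : ptensor2 := fun i j =>
  padd (padd (padd
    (popp (padd (psprod pomega_4 pomega_4 i j) (psprod pomega_5 pomega_5 i j)))
    (padd (psprod psigma_1 psigma_1 i j) (psprod psigma_2 psigma_2 i j)))
    (pmul (pquot 1 2)
      (padd (psprod pomega_1 pomega_1 i j) (psprod pomega_2 pomega_2 i j))))
    (pmul (pquot 3 2) (psprod pomega_3 pomega_3 i j)).

Lemma den_g_o (s : sign_choice) (p : point) (i j : coord) :
  sin (p ctheta) <> 0%R -> g_o s p i j = den s (pg_o i j) p.
Proof.
  intro Hs; unfold g_o, pg_o; den_expand Hs.
  rewrite <- (den_psprod s p _ _ _ _ i j Hs (den_o_1 s p Hs) (den_o_1 s p Hs)),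
    <- (den_psprod s p _ _ _ _ i j Hs (den_o_2 s p Hs)
          (den_o_2 s p Hs)),
    <- (den_psprod s p _ _ _ _ i j Hs (den_o_3 s p Hs)
          (den_o_3 s p Hs)),
    <- (den_psprod s p _ _ _ _ i j Hs (den_o_4 s p) (den_o_4 s p)),
    <- (den_psprod s p _ _ _ _ i j Hs (den_o_5 s p Hs)
          (den_o_5 s p Hs)),
    <- (den_psprod s p _ _ _ _ i j Hs (den_ot_1 s p Hs)
          (den_ot_1 s p Hs)),
    <- (den_psprod s p _ _ _ _ i j Hs (den_ot_2 s p Hs)
          (den_ot_2 s p Hs)).
  unfold ot_3; field.
Qed.

Lemma den_g_rolling (s : sign_choice) (p : point) (i j : coord) :
  sin (p ctheta) <> 0%R -> g_rolling s p i j = den s (pg_rolling i j) p.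
Proof.
  intro Hs; unfold g_rolling, pg_rolling; den_expand Hs.
  rewrite
    <- (den_psprod s p _ _ _ _ i j Hs (den_omega_1 s p Hs)
          (den_omega_1 s p Hs)),
    <- (den_psprod s p _ _ _ _ i j Hs (den_omega_2 s p Hs)
          (den_omega_2 s p Hs)),
    <- (den_psprod s p _ _ _ _ i j Hs (den_omega_3 s p Hs)
          (den_omega_3 s p Hs)),
    <- (den_psprod s p _ _ _ _ i j Hs (den_omega_4 s p Hs)
          (den_omega_4 s p Hs)),
    <- (den_psprod s p _ _ _ _ i j Hs (den_omega_5 s p Hs)
          (den_omega_5 s p Hs)),
    <- (den_psprod s p _ _ _ _ i j Hs (den_sigma_1 s p Hs)
          (den_sigma_1 s p Hs)),
    <- (den_psprod s p _ _ _ _ i j Hs (den_sigma_2 s p Hs)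
          (den_sigma_2 s p Hs)).
  field.
Qed.

(** The rolling forms are rotated by psi: sin psi omega_1 + cos psi omega_2 = o_1 and cos psi
    omega_1 - sin psi omega_2 = o_2, whence omega_1^2 + omega_2^2 = o_1^2 + o_2^2. Likewise
    omega_4^2 + omega_5^2 = o_4^2 + o_5^2, and omega_3 = -o_3. The rest is the parallelogram
    identity for sigma_1 +- h dq and sigma_2 +- dx. *)
Lemma g_o_g_rolling (s : sign_choice) (p : point) (i j : coord) :
  sin (p ctheta) <> 0%R -> g_o s p i j = g_rolling s p i j.
Proof.
  intro Hs; rewrite den_g_o, den_g_rolling by exact Hs.
  apply peqb_den; destruct i, j; vm_compute; reflexivity.
Qed.

Definition pframe (n : nat) : pform :=
  match n with
  | 1%nat => pE_1 | 2%nat => pE_2 | 3%nat => pE_3 | 4%nat => pdx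
  | _ => fun i => pmul (p_h (-1)) (p_delta cq i)
  end.

(* The inverse of g in the frame (E^1, E^2, E^3, d/dx, h^-1 d/dq). *)
Definition pg_inv : ptensor2 := fun i j =>
  fold_right (fun t P =>
    let '(c, m, n) := t in
    padd (pmul c (psprod (pframe m) (pframe n) i j)) P) nil
    ((pquot 1 2, 1, 1) :: (pquot 1 2, 2, 2) :: (pquot 5 6, 3, 3)
     :: (pquot (-3) 2, 4, 4) :: (pquot (-3) 2, 5, 5)
     :: (popp p_rate, 1, 3) :: (pquot (-1) 1, 1, 5) :: (pquot (-1) 1, 2, 4)
     :: (pmul (pquot (-3) 1) p_rate, 3, 5) :: nil)%nat.

(** * The frame (E^1, E^2, E^3, d/dx, d/dq) *)

(** Only the decision on coordinates is unfolded; the complex operations stay intact for [ring]. *)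
Ltac delta_simpl :=
  cbv beta iota delta [delta coord_eq_dec coord_rec coord_rect sumbool_rec
    sumbool_rect eq_ind_r].

Lemma sumc_delta (i : coord) (v : coord -> C) :
  sumc (fun j => delta i j * v j) = v i.
Proof. destruct i; unfold sumc; delta_simpl; ring. Qed.

Lemma frame_complete (p : point) (Hs : sin (p ctheta) <> 0%R) (i j : coord) :
  E_1 p i * sigma_1 p j + E_2 p i * sigma_2 p j + E_3 p i * sigma_3 p j
  + delta cx i * delta cx j + delta cq i * delta cq j = delta i j.
Proof.
  (* Either sign would serve, since the E^i and sigma_i do not involve h. *)
  transitivity (den Upper
    (padd (padd (padd (padd (pmul (pE_1 i) (psigma_1 j))
       (pmul (pE_2 i) (psigma_2 j))) (pmul (pE_3 i) (psigma_3 j)))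
       (pmul (p_delta cx i) (p_delta cx j)))
       (pmul (p_delta cq i) (p_delta cq j))) p).
  - den_expand Hs.
    now rewrite <- (den_E_1 Upper p Hs), <- (den_E_2 Upper p Hs),
      <- (den_E_3 Upper p), <- (den_sigma_1 Upper p Hs),
      <- (den_sigma_2 Upper p Hs), <- (den_sigma_3 Upper p Hs).
  - rewrite <- (den_delta Upper i j p); apply peqb_den.
    destruct i, j; vm_compute; reflexivity.
Qed.

Lemma vec_frame (p : point) (Hs : sin (p ctheta) <> 0%R) (v : vec)
  (i : coord) :
  v i = E_1 p i * contract (sigma_1 p) v + E_2 p i * contract (sigma_2 p) v
        + E_3 p i * contract (sigma_3 p) v
        + delta cx i * v cx + delta cq i * v cq.
Proof.
  rewrite <- (sumc_delta i v) at 1.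
  rewrite (sumc_ext _ _ (fun j => f_equal (fun z => z * v j)
    (eq_sym (frame_complete p Hs i j)))).
  unfold contract, sumc; delta_simpl; ring.
Qed.

Lemma covec_frame (p : point) (Hs : sin (p ctheta) <> 0%R) (al : covec)
  (j : coord) :
  al j = contract al (E_1 p) * sigma_1 p j + contract al (E_2 p) * sigma_2 p j
         + contract al (E_3 p) * sigma_3 p j
         + al cx * delta cx j + al cq * delta cq j.
Proof.
  assert (E : sumc (fun i => al i * delta i j) = al j)
    by (destruct j; unfold sumc; delta_simpl; ring).
  rewrite <- E at 1.
  rewrite (sumc_ext _ _ (fun i => f_equal (fun z => al i * z)
    (eq_sym (frame_complete p Hs i j)))).
  unfold contract, sumc; delta_simpl; ring.
Qed.

Lemma contract_lin (al : covec) (a b : C) (v w u : vec) :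
  (forall i, u i = a * v i + b * w i) ->
  contract al u = a * contract al v + b * contract al w.
Proof. intro H; unfold contract, sumc; rewrite !H; ring. Qed.

Lemma contract_comb3 (al a b c : covec) (x y z : C) (v : vec) :
  (forall i, al i = x * a i + y * b i + z * c i) ->
  contract al v = x * contract a v + y * contract b v + z * contract c v.
Proof. intro H; unfold contract, sumc; rewrite !H; ring. Qed.

Definition pcontract (P Q : pform) : poly := psumc (fun i => pmul (P i) (Q i)).

Lemma den_contract (s : sign_choice) (p : point) (P Q : pform) (a : form)
  (v : vfield) : sin (p ctheta) <> 0%R ->
  represents_at s p P a -> represents_at s p Q v ->
  contract (a p) (v p) = den s (pcontract P Q) p.
Proof.
  intros Hs Ha Hv; unfold pcontract, contract; rewrite den_psumc.
  apply sumc_ext; intro i; rewrite den_pmul by exact Hs.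
  now rewrite Ha, Hv.
Qed.

Lemma contract_eq (s : sign_choice) (p : point) (P Q : pform) (R : poly)
  (a : form) (v : vfield) (z : C) : sin (p ctheta) <> 0%R ->
  represents_at s p P a -> represents_at s p Q v -> den s R p = z ->
  peqb (pcontract P Q) R = true ->
  contract (a p) (v p) = z.
Proof.
  intros Hs Ha Hv <- He; rewrite (den_contract s p P Q a v) by assumption.
  now apply peqb_den.
Qed.

Section Point.
Variables (s : sign_choice) (p : point).
Hypothesis Hs : sin (p ctheta) <> 0%R.

Lemma contract_o_1 (v : vec) : contract (o_1 s p) v =
  contract (sigma_1 p) v - h_roll s (p cx) * v cq.
Proof. unfold contract, sumc, o_1; delta_simpl; ring. Qed.
Lemma contract_o_2 (v : vec) : contract (o_2 p) v =
  contract (sigma_2 p) v - v cx.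
Proof. unfold contract, sumc, o_2; delta_simpl; ring. Qed.
Lemma contract_o_3 (v : vec) : contract (o_3 s p) v =
  contract (sigma_3 p) v - roll_rate s * h_roll s (p cx) * v cq.
Proof.
  unfold contract, sumc, o_3; rewrite pm_rate; delta_simpl; ring.
Qed.

Lemma contract_X_1 (al : covec) :
  contract al (X_1 p) = al cx + contract al (E_2 p).
Proof. unfold contract, sumc, X_1; delta_simpl; ring. Qed.
Lemma contract_X_2 (al : covec) : contract al (X_2 s p) =
  al cq + h_roll s (p cx) * contract al (E_1 p)
  + roll_rate s * h_roll s (p cx) * contract al (E_3 p).
Proof.
  unfold contract, sumc, X_2, roll_rate; delta_simpl; ring.
Qed.

Ltac reflect_contract :=
  eapply (contract_eq s p _ _ nil);
  [ exact Hs
  | first [ exact (den_o_1 s p Hs) | exact (den_o_2 s p Hs)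
          | exact (den_o_3 s p Hs) | exact (den_ot_1 s p Hs)
          | exact (den_ot_2 s p Hs) ]
  | first [ exact (den_X_1 s p Hs) | exact (den_X_2 s p Hs)
          | eassumption ]
  | reflexivity
  | vm_compute; reflexivity ].

Lemma X_1_ker_o : ker3 (o_1 s) o_2 (o_3 s) p (X_1 p).
Proof. repeat split; reflect_contract. Qed.
Lemma X_2_ker_o : ker3 (o_1 s) o_2 (o_3 s) p (X_2 s p).
Proof. repeat split; reflect_contract. Qed.

(** The frame (X_1, X_2, E_1, E_2, E_3) is dual to the coframe (dx, dq, o_1, o_2, o_3): each o_i
    kills X_1 and X_2, the E_j have no x or q component, and on them o_i agrees with sigma_i.
    [covec_adapted] is the same duality read on covectors. *)
Lemma vec_adapted (v : vec) (i : coord) :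
  v i = v cx * X_1 p i + v cq * X_2 s p i
        + contract (o_1 s p) v * E_1 p i + contract (o_2 p) v * E_2 p i
        + contract (o_3 s p) v * E_3 p i.
Proof.
  rewrite contract_o_1, contract_o_2, contract_o_3.
  rewrite (vec_frame p Hs v i) at 1.
  unfold X_1, X_2; fold (roll_rate s); ring.
Qed.

Lemma covec_adapted (al : covec) (i : coord) :
  al i = contract al (E_1 p) * o_1 s p i + contract al (E_2 p) * o_2 p i
         + contract al (E_3 p) * o_3 s p i
         + contract al (X_1 p) * delta cx i
         + contract al (X_2 s p) * delta cq i.
Proof.
  rewrite contract_X_1, contract_X_2.
  rewrite (covec_frame p Hs al i) at 1.
  unfold o_1, o_2, o_3; rewrite pm_rate; ring.
Qed.

Lemma dist_D_ker (v : vec) :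
  dist_D s p v <-> ker3 (o_1 s) o_2 (o_3 s) p v.
Proof.
  split.
  - intros (a & b & Hv).
    destruct X_1_ker_o as (H11 & H12 & H13), X_2_ker_o as (H21 & H22 & H23).
    repeat split; rewrite (contract_lin _ a b (X_1 p) (X_2 s p) v Hv);
      [rewrite H11, H21 | rewrite H12, H22 | rewrite H13, H23]; ring.
  - intros (H1 & H2 & H3); exists (v cx), (v cq); intro i.
    rewrite (vec_adapted v i) at 1; rewrite H1, H2, H3; ring.
Qed.

(** Two explicit vectors of the kernel suffice. Vanishing on them expresses the dx and dq
    coefficients of [al] through its values on the E^i, and these turn each sigma_i into the
    corresponding form of the sign-reversed distribution. *)
Lemma dist_Dt_annihilator (al : covec) :
  (forall v, dist_Dt s p v -> contract al v = 0) -> exists x y z : C,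
  forall i, al i = x * ot_1 s p i + y * ot_2 p i + z * ot_3 s p i.
Proof.
  intro H.
  (* [X_1] and [X_2 s] after the sign reversal of dx and h dq. *)
  set (Y1 := fun q i => delta cx i - E_2 q i).
  set (Y2 := fun q i => delta cq i - h_roll s (q cx) * E_1 q i
                        + roll_rate s * h_roll s (q cx) * E_3 q i).
  assert (R1 : represents_at s p (fun i => psub (pdx i) (pE_2 i)) Y1).
  { intro i; unfold Y1, pdx; den_expand Hs; now rewrite (den_E_2 s p Hs). }
  assert (R2 : represents_at s p (fun i =>
    padd (psub (p_delta cq i) (pmul (p_h 1) (pE_1 i)))
         (pmul (pmul p_rate (p_h 1)) (pE_3 i))) Y2).
  { intro i; unfold Y2; den_expand Hs.
    now rewrite (den_E_1 s p Hs), (den_E_3 s p). }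
  assert (H1 : contract al (Y1 p) = 0).
  { apply H; repeat split; reflect_contract. }
  assert (H2 : contract al (Y2 p) = 0).
  { apply H; repeat split; reflect_contract. }
  exists (contract al (E_1 p)), (contract al (E_2 p)), (contract al (E_3 p)).
  intro i; rewrite (covec_frame p Hs al i) at 1.
  assert (E1 : contract al (Y1 p) = al cx - contract al (E_2 p))
    by (unfold contract, sumc, Y1; delta_simpl; ring).
  assert (E2 : contract al (Y2 p) = al cq
    - h_roll s (p cx) * contract al (E_1 p)
    + roll_rate s * h_roll s (p cx) * contract al (E_3 p))
    by (unfold contract, sumc, Y2; delta_simpl; ring).
  rewrite H1 in E1; rewrite H2 in E2.
  unfold ot_1, ot_2, ot_3, o_3; rewrite pm_rate.
  replace (al cx) with (contract al (E_2 p)).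
  - replace (al cq) with (h_roll s (p cx) * contract al (E_1 p)
      - roll_rate s * h_roll s (p cx) * contract al (E_3 p)); [ring|].
    transitivity (al cq - 0); [rewrite E2|]; ring.
  - transitivity (al cx - 0); [rewrite E1|]; ring.
Qed.

End Point.

Lemma spans_annihilator_D (U : point -> Prop) (s : sign_choice) :
  regular U -> spans_annihilator3 U (o_1 s) o_2 (o_3 s) (dist_D s).
Proof.
  intros [_ Hsin] p Hp al; pose proof (Hsin p Hp) as Hs; split.
  - intro H.
    exists (contract al (E_1 p)), (contract al (E_2 p)), (contract al (E_3 p)).
    intro i; rewrite (covec_adapted s p Hs al i) at 1.
    rewrite (H (X_1 p)), (H (X_2 s p)); [ring| |];
      apply (dist_D_ker s p Hs); auto using X_1_ker_o, X_2_ker_o.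
  - intros (x & y & z & Hal) v Hv.
    apply (dist_D_ker s p Hs) in Hv; destruct Hv as (H1 & H2 & H3).
    rewrite (contract_comb3 _ _ _ _ x y z v Hal), H1, H2, H3; ring.
Qed.

Lemma spans_annihilator_Dt (U : point -> Prop) (s : sign_choice) :
  regular U -> spans_annihilator3 U (ot_1 s) ot_2 (ot_3 s) (dist_Dt s).
Proof.
  intros [_ Hsin] p Hp al; split.
  - apply dist_Dt_annihilator; auto.
  - intros (x & y & z & Hal) v (H1 & H2 & H3).
    rewrite (contract_comb3 _ _ _ _ x y z v Hal), H1, H2, H3; ring.
Qed.

(** * The growth vector (2, 3, 5) *)

Definition lie_bracket_poly (X Y : pform) : pform := fun i =>
  psumc (fun j =>
    psub (pmul (X j) (pdiff j (Y i))) (pmul (Y j) (pdiff j (X i)))).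

Definition represents_field (V : point -> Prop) (s : sign_choice)
  (P : pform) (X : point -> coord -> C) : Prop :=
  forall p, V p -> represents_at s p P X.

Lemma represents_lie_bracket (V : point -> Prop) (s : sign_choice)
  (P Q : pform) (X Y : vfield) : regular V ->
  represents_field V s P X -> represents_field V s Q Y ->
  represents_field V s (lie_bracket_poly P Q) (lie_bracket X Y).
Proof.
  intros HV HX HY p Hp i; unfold lie_bracket, lie_bracket_poly.
  rewrite den_psumc; apply sumc_ext; intro j.
  rewrite den_psub, !den_pmul by (apply HV, Hp).
  rewrite (represents_pd V s (Q i) (fun q => Y q i) j HV
    (fun q Hq => HY q Hq i) p Hp).
  rewrite (represents_pd V s (P i) (fun q => X q i) j HV
    (fun q Hq => HX q Hq i) p Hp).
  now rewrite (HX p Hp), (HY p Hp).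
Qed.

Lemma represents_smooth_field (V : point -> Prop) (s : sign_choice)
  (P : pform) (X : point -> coord -> C) :
  regular V -> represents_field V s P X -> smooth_field V X.
Proof.
  intros HV HX i; apply (represents_smooth V s (P i)); [exact HV|].
  intros p Hp; now apply HX.
Qed.

(** Leibniz' rule applied to the constant function a(X) = 0. It supplies the terms by which a([X,Y])
    and -da(X,Y) differ. Smoothness makes each summand differentiable, so that the derivative of the
    sum may be split. *)
Lemma pd_contract_zero (V : point -> Prop) (a : form) (X : vfield)
  (j : coord) (p : point) :
  open V -> V p -> smooth_field V a -> smooth_field V X ->
  (forall q, V q -> contract (a q) (X q) = 0) ->
  sumc (fun i => pd j (fun q => a q i) p * X p i
                 + a p i * pd j (fun q => X q i) p) = 0.
Proof.
  intros HV Hp Ha HX H0.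
  assert (Hi : forall i, is_pd j (fun q => a q i * X q i) p
    (pd j (fun q => a q i) p * X p i + a p i * pd j (fun q => X q i) p)).
  { intro i; apply (is_pd_mult j (fun q => a q i) (fun q => X q i));
      apply ex_pd_is_pd; now apply (smooth_ex_pd V). }
  rewrite <- (is_pd_unique j (fun q => contract (a q) (X q)) p
    (sumc (fun i => pd j (fun q => a q i) p * X p i
                    + a p i * pd j (fun q => X q i) p))).
  - transitivity (pd j (fun _ => 0) p).
    + now apply (pd_ext V).
    + apply is_pd_unique, is_pd_const.
  - unfold contract, sumc.
    do 4 (apply is_pd_plus; [|apply Hi]); apply Hi.
Qed.

(* Cartan's formula a([X,Y]) = - da(X,Y) when a(X) = a(Y) = 0. *)
Lemma contract_lie_bracket (V : point -> Prop) (a : form) (X Y : vfield)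
  (p : point) :
  open V -> V p -> smooth_field V a -> smooth_field V X -> smooth_field V Y ->
  (forall q, V q -> contract (a q) (X q) = 0) ->
  (forall q, V q -> contract (a q) (Y q) = 0) ->
  contract (a p) (lie_bracket X Y p) =
  - sumc (fun i => sumc (fun j => ext_d a p i j * (X p i * Y p j))).
Proof.
  intros HV Hp Ha HX HY HaX HaY.
  assert (EX := fun j => pd_contract_zero V a X j p HV Hp Ha HX HaX).
  assert (EY := fun j => pd_contract_zero V a Y j p HV Hp Ha HY HaY).
  transitivity (sumc (fun j =>
    X p j * sumc (fun i => pd j (fun q => a q i) p * Y p i
                           + a p i * pd j (fun q => Y q i) p)
    - Y p j * sumc (fun i => pd j (fun q => a q i) p * X p i
                             + a p i * pd j (fun q => X q i) p))
    - sumc (fun i => sumc (fun j => ext_d a p i j * (X p i * Y p j)))).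
  - unfold contract, lie_bracket, ext_d, sumc; ring.
  - rewrite (sumc_ext _ (fun _ => 0)).
    + unfold sumc; ring.
    + intro j; rewrite EX, EY; ring.
Qed.

Definition ext_d_poly (a : pform) : ptensor2 := fun i j =>
  psub (pdiff i (a j)) (pdiff j (a i)).

Lemma represents_ext_d (V : point -> Prop) (s : sign_choice) (P : pform)
  (a : form) (p : point) (i j : coord) :
  regular V -> represents_field V s P a -> V p ->
  ext_d a p i j = den s (ext_d_poly P i j) p.
Proof.
  intros HV Ha Hp; unfold ext_d, ext_d_poly; rewrite den_psub.
  rewrite (represents_pd V s (P j) (fun q => a q j) i HV
    (fun q Hq => Ha q Hq j) p Hp).
  now rewrite (represents_pd V s (P i) (fun q => a q i) j HV
    (fun q Hq => Ha q Hq i) p Hp).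
Qed.

(** D has rank 2, so the 2-form da restricted to D is determined by its single value da(X_1,X_2).
    One polynomial identity therefore controls the brackets of all smooth sections. *)
Lemma contract_bracket_D (V : point -> Prop) (s : sign_choice) (P : pform)
  (a : form) (X Y : vfield) (p : point) :
  regular V -> V p -> represents_field V s P a ->
  (forall q, V q -> contract (a q) (X_1 q) = 0) ->
  (forall q, V q -> contract (a q) (X_2 s q) = 0) ->
  peqb (psumc (fun i => psumc (fun j =>
    pmul (ext_d_poly P i j) (pmul (pX_1 i) (pX_2 j))))) nil = true ->
  smooth_section V (dist_D s) X -> smooth_section V (dist_D s) Y ->
  contract (a p) (lie_bracket X Y p) = 0.
Proof.
  intros HV Hp Ha H1 H2 Hd [HX HXD] [HY HYD].
  assert (H0 : forall Z, (forall q, V q -> dist_D s q (Z q)) ->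
    forall q, V q -> contract (a q) (Z q) = 0).
  { intros Z HZ q Hq; destruct (HZ q Hq) as (b & c & E).
    rewrite (contract_lin _ b c _ _ _ E), H1, H2 by exact Hq; ring. }
  rewrite (contract_lie_bracket V a X Y p (proj1 HV) Hp
    (represents_smooth_field V s P a HV Ha) HX HY (H0 X HXD) (H0 Y HYD)).
  destruct (HXD p Hp) as (x1 & x2 & EX), (HYD p Hp) as (y1 & y2 & EY).
  pose proof (proj2 HV p Hp) as Hs.
  apply (peqb_den s _ nil p) in Hd; rewrite den_nil, den_psumc in Hd.
  assert (Hd' : sumc (fun i => sumc (fun j =>
    ext_d a p i j * (X_1 p i * X_2 s p j))) = 0).
  { rewrite <- Hd; apply sumc_ext; intro i; rewrite den_psumc.
    apply sumc_ext; intro j; rewrite !den_pmul by exact Hs.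
    now rewrite (represents_ext_d V s P a p i j HV Ha Hp),
      (den_X_1 s p Hs), (den_X_2 s p Hs). }
  (* The determinant of the coefficients of X and Y at [p] appears; [ring] finds it once [ext_d] is
     unfolded and its antisymmetry is visible. *)
  transitivity (- (x1 * y2 - x2 * y1) * sumc (fun i => sumc (fun j =>
    ext_d a p i j * (X_1 p i * X_2 s p j)))); [|rewrite Hd'; ring].
  unfold sumc; rewrite !EX, !EY; unfold ext_d; ring.
Qed.

Lemma Ck_subset (V W : point -> Prop) (k : nat) :
  (forall p, W p -> V p) -> forall f, Ck k V f -> Ck k W f.
Proof.
  intro HW; induction k as [|k IH]; cbn; intros f Hf.
  - auto.
  - destruct Hf as [Hf Hd]; split; [auto|]; intro i.
    destruct (Hd i) as [He Hk]; split; auto.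
Qed.

Lemma smooth_section_subset (V W : point -> Prop) (D : distribution)
  (X : vfield) : (forall p, W p -> V p) ->
  smooth_section V D X -> smooth_section W D X.
Proof.
  intros HW [HX HD]; split; [|auto].
  intros i k; apply (Ck_subset V); [exact HW | apply HX].
Qed.

Lemma contract_lin_comb_zero (al : covec) (n : nat) (c : nat -> C)
  (b : nat -> vec) :
  (forall k, (1 <= k <= n)%nat -> contract al (b k) = 0) ->
  contract al (lin_comb n c b) = 0.
Proof.
  induction n as [|n IH]; intro H.
  - unfold contract, sumc, lin_comb; cbn [Csum]; ring.
  - rewrite (contract_lin al 1 (c (S n)) (lin_comb n c b) (b (S n))).
    + rewrite IH by (intros; apply H; lia); rewrite H by lia; ring.
    + intro i; unfold lin_comb; cbn [Csum]; ring.
Qed.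

Lemma lie_bracket_eq (V : point -> Prop) (s : sign_choice) (P Q R : pform)
  (X Y Z : vfield) (p : point) (i : coord) : regular V -> V p ->
  represents_field V s P X -> represents_field V s Q Y ->
  represents_at s p R Z ->
  all_coord (fun i => peqb (lie_bracket_poly P Q i) (R i)) = true ->
  lie_bracket X Y p i = Z p i.
Proof.
  intros HV Hp HX HY HZ Hc.
  rewrite (represents_lie_bracket V s P Q X Y HV HX HY p Hp i), HZ.
  exact (peqb_den s _ _ p (all_coord_forall _ Hc i)).
Qed.

(** [bracket_dist] contains brackets only, so D itself has to be recovered from brackets. Since
    X_1(h) = a h vanishes nowhere, [X_1, h X_1] = a h X_1 gives back X_1, and [X_1, h X_2] gives
    back X_2 up to a multiple of [X_1, X_2]. *)
Definition hX_1 (s : sign_choice) : vfield := fun p i =>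
  h_roll s (p cx) * X_1 p i.
Definition hX_2 (s : sign_choice) : vfield := fun p i =>
  h_roll s (p cx) * X_2 s p i.

Lemma roll_rate_neq_0 (s : sign_choice) : roll_rate s <> 0.
Proof.
  intro H; pose proof (roll_rate_sqr s) as E; rewrite H in E.
  apply C1_nz; transitivity (- 9 * (- / 9)); [field|].
  rewrite <- E; ring.
Qed.

Section Brackets.
Variables (U : point -> Prop) (s : sign_choice).
Hypothesis HU : regular U.

Lemma field_X_1 : represents_field U s pX_1 X_1.
Proof. intros p Hp; apply den_X_1, HU, Hp. Qed.
Lemma field_X_2 : represents_field U s pX_2 (X_2 s).
Proof. intros p Hp; apply den_X_2, HU, Hp. Qed.
Lemma field_E_3 : represents_field U s pE_3 E_3.
Proof. intros p Hp; apply den_E_3. Qed.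
Lemma field_hX_1 :
  represents_field U s (fun i => pmul (p_h 1) (pX_1 i)) (hX_1 s).
Proof.
  intros p Hp i; pose proof (proj2 HU p Hp) as Hs.
  unfold hX_1; den_expand Hs; now rewrite (den_X_1 s p Hs).
Qed.
Lemma field_hX_2 :
  represents_field U s (fun i => pmul (p_h 1) (pX_2 i)) (hX_2 s).
Proof.
  intros p Hp i; pose proof (proj2 HU p Hp) as Hs.
  unfold hX_2; den_expand Hs; now rewrite (den_X_2 s p Hs).
Qed.

(** The constant is 1 + a^2: h E_3 comes from h [E_2, E_1], and a^2 h E_3 from differentiating a h.
    The E_1 terms a h E_1 and a h [E_2, E_3] = -a h E_1 cancel. *)
Lemma bracket_X_1_X_2 (p : point) (i : coord) : U p ->
  lie_bracket X_1 (X_2 s) p i = 8 / 9 * (h_roll s (p cx) * E_3 p i).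
Proof.
  intro Hp; pose proof (proj2 HU p Hp) as Hs.
  apply (lie_bracket_eq U s pX_1 pX_2
    (fun i => pmul (pquot 8 9) (pmul (p_h 1) (pE_3 i))) _ _
    (fun p i => 8 / 9 * (h_roll s (p cx) * E_3 p i)) p i HU Hp
    field_X_1 field_X_2); [|vm_compute; reflexivity].
  intro j; den_expand Hs; now rewrite (den_E_3 s p).
Qed.

Lemma bracket_X_1_hX_1 (p : point) (i : coord) : U p ->
  lie_bracket X_1 (hX_1 s) p i = roll_rate s * (h_roll s (p cx) * X_1 p i).
Proof.
  intro Hp; pose proof (proj2 HU p Hp) as Hs.
  apply (lie_bracket_eq U s pX_1 (fun i => pmul (p_h 1) (pX_1 i))
    (fun i => pmul p_rate (pmul (p_h 1) (pX_1 i))) _ _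
    (fun p i => roll_rate s * (h_roll s (p cx) * X_1 p i)) p i HU Hp
    field_X_1 field_hX_1); [|vm_compute; reflexivity].
  intro j; den_expand Hs; now rewrite (den_X_1 s p Hs).
Qed.

Lemma bracket_X_1_hX_2 (p : point) (i : coord) : U p ->
  lie_bracket X_1 (hX_2 s) p i =
  roll_rate s * (h_roll s (p cx) * X_2 s p i)
  + 8 / 9 * (h_roll s (p cx) * (h_roll s (p cx) * E_3 p i)).
Proof.
  intro Hp; pose proof (proj2 HU p Hp) as Hs.
  apply (lie_bracket_eq U s pX_1 (fun i => pmul (p_h 1) (pX_2 i))
    (fun i => padd (pmul p_rate (pmul (p_h 1) (pX_2 i)))
      (pmul (pquot 8 9) (pmul (p_h 1) (pmul (p_h 1) (pE_3 i))))) _ _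
    (fun p i => roll_rate s * (h_roll s (p cx) * X_2 s p i)
      + 8 / 9 * (h_roll s (p cx) * (h_roll s (p cx) * E_3 p i))) p i HU Hp
    field_X_1 field_hX_2); [|vm_compute; reflexivity].
  intro j; den_expand Hs; now rewrite (den_X_2 s p Hs), (den_E_3 s p).
Qed.

Lemma bracket_E_3_X_1 (p : point) (i : coord) : U p ->
  lie_bracket E_3 X_1 p i = E_1 p i.
Proof.
  intro Hp; apply (lie_bracket_eq U s pE_3 pX_1 pE_1 _ _ E_1 p i HU Hp
    field_E_3 field_X_1); [|vm_compute; reflexivity].
  apply den_E_1, HU, Hp.
Qed.

Lemma bracket_E_3_X_2 (p : point) (i : coord) : U p ->
  lie_bracket E_3 (X_2 s) p i = - (h_roll s (p cx) * E_2 p i).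
Proof.
  intro Hp; pose proof (proj2 HU p Hp) as Hs.
  apply (lie_bracket_eq U s pE_3 pX_2
    (fun i => popp (pmul (p_h 1) (pE_2 i))) _ _
    (fun p i => - (h_roll s (p cx) * E_2 p i)) p i HU Hp
    field_E_3 field_X_2); [|vm_compute; reflexivity].
  intro j; den_expand Hs; now rewrite (den_E_2 s p Hs).
Qed.

Lemma section_D (P : pform) (X : vfield) :
  represents_field U s P X ->
  (forall p, exists a b : C, forall i, X p i = a * X_1 p i + b * X_2 s p i) ->
  smooth_section U (dist_D s) X.
Proof.
  intros HX HD; split; [now apply (represents_smooth_field U s P)|].
  intros p _; exact (HD p).
Qed.

Lemma section_X_1 : smooth_section U (dist_D s) X_1.
Proof.
  apply (section_D _ _ field_X_1); intro p; exists 1, 0; intro; ring.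
Qed.
Lemma section_X_2 : smooth_section U (dist_D s) (X_2 s).
Proof.
  apply (section_D _ _ field_X_2); intro p; exists 0, 1; intro; ring.
Qed.
Lemma section_hX_1 : smooth_section U (dist_D s) (hX_1 s).
Proof.
  apply (section_D _ _ field_hX_1); intro p; exists (h_roll s (p cx)), 0.
  intro; unfold hX_1; ring.
Qed.
Lemma section_hX_2 : smooth_section U (dist_D s) (hX_2 s).
Proof.
  apply (section_D _ _ field_hX_2); intro p; exists 0, (h_roll s (p cx)).
  intro; unfold hX_2; ring.
Qed.

(** Brackets of sections stay in the kernel of o_1 and o_2 because d(o_1) and d(o_2) vanish on D.
    Conversely, this kernel is spanned by X_1, X_2 and E_3, which three explicit brackets
    produce. *)
Lemma bracket_DD (p : point) (v : vec) : U p ->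
  bracket_dist (dist_D s) (dist_D s) p v <->
  contract (o_1 s p) v = 0 /\ contract (o_2 p) v = 0.
Proof.
  intro Hp; pose proof (proj2 HU p Hp) as Hs; split.
  - intros (n & c & b & Hb & Hv).
    assert (Hk : forall k, (1 <= k <= n)%nat ->
      contract (o_1 s p) (b k) = 0 /\ contract (o_2 p) (b k) = 0).
    { intros k Hk.
      destruct (Hb k Hk) as (V & X & Y & HV & HVp & HX & HY & ->).
      (* The sections live on an arbitrary open set, on which sin theta may vanish; intersecting
         with [U] makes it regular. *)
      set (W := fun q => V q /\ U q).
      assert (HW : regular W).
      { split; [now apply open_and; [|apply HU]|].
        intros q [_ Hq]; now apply HU. }
      assert (HWV : forall q, W q -> V q) by (now intros q [Hq _]).
      apply (smooth_section_subset V W _ _ HWV) in HX, HY.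
      split.
      - apply (contract_bracket_D W s po_1); try assumption.
        + now split.
        + intros q Hq; apply den_o_1, HW, Hq.
        + intros q Hq; apply (X_1_ker_o s q), HW, Hq.
        + intros q Hq; apply (X_2_ker_o s q), HW, Hq.
        + vm_compute; reflexivity.
      - apply (contract_bracket_D W s po_2); try assumption.
        + now split.
        + intros q Hq; apply den_o_2, HW, Hq.
        + intros q Hq; apply (X_1_ker_o s q), HW, Hq.
        + intros q Hq; apply (X_2_ker_o s q), HW, Hq.
        + vm_compute; reflexivity. }
    assert (Ev : forall al, contract al v = contract al (lin_comb n c b))
      by (intro al; unfold contract, sumc; now rewrite !Hv).
    rewrite !Ev; split; apply contract_lin_comb_zero; intros k Hk';
      apply Hk, Hk'.
  - intros [H1 H2].
    pose proof (roll_rate_neq_0 s) as Ha.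
    pose proof (h_roll_neq_0 s (p cx)) as Hh.
    set (a := roll_rate s) in *; set (h := h_roll s (p cx)) in *.
    (* The coefficients invert the triangular system given by a h X_1, a h X_2 + 8/9 h^2 E_3 and 8/9
       h E_3. The term - v cq / a compensates the E_3 part of the second bracket. *)
    exists 3%nat, (fun k => match k with
      | 1%nat => v cx / (a * h)
      | 2%nat => v cq / (a * h)
      | _ => 9 / 8 * contract (o_3 s p) v / h - v cq / a
      end), (fun k => match k with
      | 1%nat => lie_bracket X_1 (hX_1 s) p
      | 2%nat => lie_bracket X_1 (hX_2 s) p
      | _ => lie_bracket X_1 (X_2 s) p
      end); split.
    + intros k Hk.
      destruct k as [|[|[|k]]]; [lia| | |]; exists U; do 2 eexists;
        (split; [apply HU|]); (split; [exact Hp|]);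
        (split; [exact section_X_1|]).
      * split; [exact section_hX_1 | reflexivity].
      * split; [exact section_hX_2 | reflexivity].
      * split; [exact section_X_2 | reflexivity].
    + intro i; unfold lin_comb; cbn [Csum].
      rewrite bracket_X_1_hX_1, bracket_X_1_hX_2, bracket_X_1_X_2 by exact Hp.
      rewrite (vec_adapted s p Hs v i) at 1; rewrite H1, H2.
      fold a h; field; auto.
Qed.

Lemma section_DD (P : pform) (X : vfield) :
  represents_field U s P X ->
  (forall p, U p -> contract (o_1 s p) (X p) = 0) ->
  (forall p, U p -> contract (o_2 p) (X p) = 0) ->
  smooth_section U (bracket_dist (dist_D s) (dist_D s)) X.
Proof.
  intros HX H1 H2; split; [now apply (represents_smooth_field U s P)|].
  intros p Hp; apply bracket_DD; auto.
Qed.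

Lemma o_1_E_3 (p : point) : U p -> contract (o_1 s p) (E_3 p) = 0.
Proof.
  intro Hp; pose proof (proj2 HU p Hp) as Hs.
  apply (contract_eq s p po_1 pE_3 nil _ _ _ Hs (den_o_1 s p Hs)
    (den_E_3 s p)); vm_compute; reflexivity.
Qed.

Lemma o_2_E_3 (p : point) : U p -> contract (o_2 p) (E_3 p) = 0.
Proof.
  intro Hp; pose proof (proj2 HU p Hp) as Hs.
  apply (contract_eq s p po_2 pE_3 nil _ _ _ Hs (den_o_2 s p Hs)
    (den_E_3 s p)); vm_compute; reflexivity.
Qed.

Lemma bracket_DDD (p : point) (v : vec) : U p ->
  bracket_dist (bracket_dist (dist_D s) (dist_D s)) (dist_D s) p v.
Proof.
  intro Hp; pose proof (proj2 HU p Hp) as Hs.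
  pose proof (roll_rate_neq_0 s) as Ha.
  pose proof (h_roll_neq_0 s (p cx)) as Hh.
  set (a := roll_rate s) in *; set (h := h_roll s (p cx)) in *.
  assert (S1 : smooth_section U (bracket_dist (dist_D s) (dist_D s)) X_1).
  { apply (section_DD _ _ field_X_1); intros q Hq;
      apply (X_1_ker_o s q), HU, Hq. }
  assert (S3 : smooth_section U (bracket_dist (dist_D s) (dist_D s)) E_3).
  { apply (section_DD _ _ field_E_3); intros q Hq;
      [now apply o_1_E_3 | now apply o_2_E_3]. }
  (* The first three terms are those of the spanning of [D,D], now with X_1 regarded as a section of
     [D,D]. The last two add the missing directions by [E_3, X_1] = E_1 and [E_3, X_2] = -h E_2. *)
  exists 5%nat, (fun k => match k with
    | 1%nat => v cx / (a * h)
    | 2%nat => v cq / (a * h)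
    | 3%nat => 9 / 8 * contract (o_3 s p) v / h - v cq / a
    | 4%nat => contract (o_1 s p) v
    | _ => - contract (o_2 p) v / h
    end), (fun k => match k with
    | 1%nat => lie_bracket X_1 (hX_1 s) p
    | 2%nat => lie_bracket X_1 (hX_2 s) p
    | 3%nat => lie_bracket X_1 (X_2 s) p
    | 4%nat => lie_bracket E_3 X_1 p
    | _ => lie_bracket E_3 (X_2 s) p
    end); split.
  - intros k Hk; destruct k as [|[|[|[|[|k]]]]]; [lia| | | | |];
      exists U; do 2 eexists; (split; [apply HU|]); (split; [exact Hp|]).
    + split; [exact S1|]; split; [exact section_hX_1 | reflexivity].
    + split; [exact S1|]; split; [exact section_hX_2 | reflexivity].
    + split; [exact S1|]; split; [exact section_X_2 | reflexivity].
    + split; [exact S3|]; split; [exact section_X_1 | reflexivity].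
    + split; [exact S3|]; split; [exact section_X_2 | reflexivity].
  - intro i; unfold lin_comb; cbn [Csum].
    rewrite bracket_X_1_hX_1, bracket_X_1_hX_2, bracket_X_1_X_2,
      bracket_E_3_X_1, bracket_E_3_X_2 by exact Hp.
    rewrite (vec_adapted s p Hs v i) at 1.
    fold a h; field; auto.
Qed.

Lemma X_1_cx (p : point) : X_1 p cx = 1.
Proof. unfold X_1, E_2; delta_simpl; ring. Qed.
Lemma X_1_cq (p : point) : X_1 p cq = 0.
Proof. unfold X_1, E_2; delta_simpl; ring. Qed.
Lemma X_2_cx (p : point) : X_2 s p cx = 0.
Proof. unfold X_2, E_1, E_3; delta_simpl; ring. Qed.
Lemma X_2_cq (p : point) : X_2 s p cq = 1.
Proof. unfold X_2, E_1, E_3; delta_simpl; ring. Qed.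

Lemma rank_D : rank_dist 2 U (dist_D s).
Proof.
  intros p Hp; exists U,
    (fun k => match k with 1%nat => X_1 | _ => X_2 s end).
  split; [apply HU|]; split; [exact Hp|]; split.
  - intros k Hk; destruct k as [|[|k]]; [lia| |].
    + exact (proj1 section_X_1).
    + exact (proj1 section_X_2).
  - intros q Hq; split.
    + intros c Hc k Hk.
      pose proof (Hc cx) as Hx; pose proof (Hc cq) as Hq'.
      unfold lin_comb in Hx, Hq'; cbn [Csum] in Hx, Hq'.
      rewrite X_1_cx, X_2_cx in Hx; rewrite X_1_cq, X_2_cq in Hq'.
      destruct k as [|[|[|k]]]; [lia| | |lia].
      * rewrite <- Hx; ring.
      * rewrite <- Hq'; ring.
    + intro v; split.
      * intros (a & b & Hv).
        exists (fun k => match k with 1%nat => a | _ => b end); intro i.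
        rewrite Hv; unfold lin_comb; cbn [Csum]; ring.
      * intros [c Hc]; exists (c 1%nat), (c 2%nat); intro i.
        rewrite Hc; unfold lin_comb; cbn [Csum]; ring.
Qed.

Lemma rank_DD : rank_dist 3 U (bracket_dist (dist_D s) (dist_D s)).
Proof.
  intros p Hp; exists U, (fun k =>
    match k with 1%nat => X_1 | 2%nat => X_2 s | _ => E_3 end).
  split; [apply HU|]; split; [exact Hp|]; split.
  - intros k Hk; destruct k as [|[|[|k]]]; [lia| | |].
    + exact (proj1 section_X_1).
    + exact (proj1 section_X_2).
    + exact (represents_smooth_field U s _ _ HU field_E_3).
  - intros q Hq; pose proof (proj2 HU q Hq) as Hs; split.
    + intros c Hc k Hk.
      (* The x and q components isolate the coefficients of X_1 and X_2; the psi component, which is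
         -1 for E_3, then isolates the third. *)
      pose proof (Hc cx) as Hx; pose proof (Hc cq) as Hq'.
      pose proof (Hc cpsi) as Hpsi.
      unfold lin_comb in Hx, Hq', Hpsi; cbn [Csum] in Hx, Hq', Hpsi.
      rewrite X_1_cx, X_2_cx in Hx; rewrite X_1_cq, X_2_cq in Hq'.
      unfold E_3 in Hx, Hq', Hpsi; revert Hx Hq' Hpsi.
      delta_simpl; intros Hx Hq' Hpsi.
      assert (H1 : c 1%nat = 0) by (rewrite <- Hx; ring).
      assert (H2 : c 2%nat = 0) by (rewrite <- Hq'; ring).
      rewrite H1, H2 in Hpsi.
      destruct k as [|[|[|[|k]]]]; [lia|exact H1|exact H2| |lia].
      transitivity (- (0 : C)); [rewrite <- Hpsi|]; ring.
    + intro v; rewrite (bracket_DD q v Hq); split.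
      * intros [H1 H2]; exists (fun k => match k with
          1%nat => v cx | 2%nat => v cq | _ => contract (o_3 s q) v end).
        intro i; unfold lin_comb; cbn [Csum].
        rewrite (vec_adapted s q Hs v i) at 1; rewrite H1, H2; ring.
      * intros [c Hc].
        assert (Ev : forall al, contract al v = contract al (lin_comb 3 c
          (fun k => match k with
             1%nat => X_1 | 2%nat => X_2 s | _ => E_3 end q)))
          by (intro al; unfold contract, sumc; now rewrite !Hc).
        destruct (X_1_ker_o s q Hs) as (A1 & A2 & _).
        destruct (X_2_ker_o s q Hs) as (B1 & B2 & _).
        rewrite !Ev; split; apply contract_lin_comb_zero; intros k Hk;
          destruct k as [|[|[|k]]]; try lia; try assumption;
          [now apply o_1_E_3 | now apply o_2_E_3].
Qed.

Lemma D_235 : distribution_235 U (dist_D s).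
Proof.
  split; [exact rank_D|]; split; [exact rank_DD|].
  intros p Hp v; now apply bracket_DDD.
Qed.

End Brackets.

(** * An adapted coframe satisfying Cartan's structure equations *)

(** The factor 9/8 = 1/(1 + a^2) compensates [X_1, X_2] = (1 + a^2) h E_3, so that d theta_3 has
    leading term theta_4 /\ theta_5. The brackets of E_3 with X_1 and X_2 carry no such constant,
    hence theta_1 and theta_2 have the same factor as theta_3. The multiples 3/4 of o_2 and o_1 do
    not change theta_4 and theta_5 on D; in the Cartan metric they create the squares of o_1 and
    o_2. *)
Definition theta_1 (s : sign_choice) : form := fscal (9 / 8) (o_1 s).
Definition theta_2 : form := fscal (9 / 8) o_2.
Definition theta_3 (s : sign_choice) : form := fscal (9 / 8) (o_3 s).
Definition theta_4 : form := fadd o_4 (fscal (- 3 / 4) o_2).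
Definition theta_5 (s : sign_choice) : form :=
  fadd (o_5 s) (fscal (3 / 4) (o_1 s)).

Definition pfadd (a b : pform) : pform := fun i => padd (a i) (b i).
Definition pfscal (c : poly) (a : pform) : pform := fun i => pmul c (a i).

Definition ptheta (k : nat) : pform :=
  match k with
  | 1%nat => pfscal (pquot 9 8) po_1
  | 2%nat => pfscal (pquot 9 8) po_2
  | 3%nat => pfscal (pquot 9 8) po_3
  | 4%nat => pfadd po_4 (pfscal (pquot (-3) 4) po_2)
  | _ => pfadd po_5 (pfscal (pquot 3 4) po_1)
  end.

Lemma den_fadd (s : sign_choice) (p : point) (P Q : pform) (a b : form) :
  represents_at s p P a -> represents_at s p Q b ->
  represents_at s p (pfadd P Q) (fadd a b).
Proof.
  intros Ha Hb i; unfold fadd, pfadd; now rewrite den_padd, Ha, Hb.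
Qed.

Lemma den_fscal (s : sign_choice) (p : point) (c : C) (R : poly) (P : pform)
  (a : form) : sin (p ctheta) <> 0%R -> den s R p = c ->
  represents_at s p P a -> represents_at s p (pfscal R P) (fscal c a).
Proof.
  intros Hs <- Ha i; unfold fscal, pfscal.
  now rewrite den_pmul, Ha by exact Hs.
Qed.

Lemma den_theta (s : sign_choice) (p : point) (k : nat) :
  sin (p ctheta) <> 0%R -> represents_at s p (ptheta k)
  (family5 (theta_1 s) theta_2 (theta_3 s) theta_4 (theta_5 s) k).
Proof.
  intro Hs.
  assert (H5 : represents_at s p (pfadd po_5 (pfscal (pquot 3 4) po_1))
    (theta_5 s)).
  { apply den_fadd; [now apply den_o_5 | apply den_fscal; [exact Hs| |]].
    - apply den_pquot.
    - now apply den_o_1. }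
  destruct k as [|[|[|[|[|k]]]]]; try exact H5; cbn [ptheta family5].
  - apply den_fscal; [exact Hs | apply den_pquot | now apply den_o_1].
  - apply den_fscal; [exact Hs | apply den_pquot | now apply den_o_2].
  - apply den_fscal; [exact Hs | apply den_pquot | now apply den_o_3].
  - apply den_fadd; [apply den_o_4 | apply den_fscal; [exact Hs| |]].
    + rewrite den_pquot; f_equal; now rewrite opp_IZR, RtoC_opp.
    + now apply den_o_2.
Qed.

(** In the invariant coframe the structure equations are linear equations for these constants. The
    solution used has Omega_1 = 0. *)
Definition pOmega (k : nat) : pform :=
  match k with
  | 1%nat => fun _ => nil
  | 2%nat => pfadd (pfscal (pmul (pquot 3 4) p_rate) psigma_1)
                   (pfscal (pquot 1 4) psigma_3)
  | 3%nat => pfadd (pfscal (pquot (-1) 4) psigma_3)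
                   (pfscal (pmul (pquot (-3) 4) p_rate) phdq)
  | 4%nat => pfadd (pfscal (pmul (pquot 3 4) p_rate) psigma_2)
                   (pfscal (pmul (pquot (-3) 4) p_rate) pdx)
  | 5%nat => pfadd (pfscal (pquot 1 4) psigma_2) (pfscal (pquot 1 12) pdx)
  | 6%nat => pfadd (pfscal (pquot (-1) 4) psigma_1)
                   (pfscal (pmul (pquot 3 4) p_rate) psigma_3)
  | _ => pfadd (pfscal (pmul (pquot 1 2) p_rate) psigma_1)
               (pfscal (pquot 1 6) psigma_3)
  end.

(** The connection forms do not occur in the statement, so they can be defined by evaluation and
    agree with their polynomials by reflexivity. *)
Definition Omega (s : sign_choice) (k : nat) : form :=
  fun p i => den s (pOmega k i) p.

Lemma den_Omega (s : sign_choice) (p : point) (k : nat) :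
  represents_at s p (pOmega k) (Omega s k).
Proof. intro i; reflexivity. Qed.

Definition wedge_poly (a b : pform) : ptensor2 := fun i j =>
  psub (pmul (a i) (b j)) (pmul (a j) (b i)).

Lemma den_wedge (s : sign_choice) (p : point) (P Q : pform) (a b : form)
  (i j : coord) : sin (p ctheta) <> 0%R ->
  represents_at s p P a -> represents_at s p Q b ->
  wedge a b p i j = den s (wedge_poly P Q i j) p.
Proof.
  intros Hs Ha Hb; unfold wedge, wedge_poly; den_expand Hs.
  now rewrite <- !Ha, <- !Hb.
Qed.

Definition cartan_rhs (k : nat) : ptensor2 := fun i j =>
  let w (m : nat) (a : pform) := wedge_poly (ptheta m) a i j in
  let double := pfscal (pquot 2 1) in
  let Om := pOmega in
  match k with
  | 1 => padd (padd (w 1 (pfadd (double (Om 1)) (Om 4))) (w 2 (Om 2)))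
              (w 3 (ptheta 4))
  | 2 => padd (padd (w 1 (Om 3)) (w 2 (pfadd (Om 1) (double (Om 4)))))
              (w 3 (ptheta 5))
  | 3 => padd (padd (padd (w 1 (Om 5)) (w 2 (Om 6)))
                    (w 3 (pfadd (Om 1) (Om 4))))
              (w 4 (ptheta 5))
  | 4 => padd (padd (padd (w 1 (Om 7)) (pmul (pquot 4 3) (w 3 (Om 6))))
                    (w 4 (Om 1)))
              (w 5 (Om 2))
  | _ => padd (padd (psub (w 2 (Om 7)) (pmul (pquot 4 3) (w 3 (Om 5))))
                    (w 4 (Om 3)))
              (w 5 (Om 4))
  end%nat.

Lemma cartan_equations (k : nat) (i j : coord) : (1 <= k <= 5)%nat ->
  peqb (ext_d_poly (ptheta k) i j) (cartan_rhs k i j) = true.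
Proof.
  intro Hk; destruct k as [|[|[|[|[|[|k]]]]]]; try lia;
    apply (all_coord_forall (fun j => peqb (ext_d_poly (ptheta _) i j)
      (cartan_rhs _ i j)));
    destruct i; vm_compute; reflexivity.
Qed.

Lemma theta_cartan_structure (U : point -> Prop) (s : sign_choice) :
  regular U ->
  cartan_structure U (theta_1 s) theta_2 (theta_3 s) theta_4 (theta_5 s)
    (Omega s 1) (Omega s 2) (Omega s 3) (Omega s 4) (Omega s 5) (Omega s 6)
    (Omega s 7).
Proof.
  intros HU p Hp i j; pose proof (proj2 HU p Hp) as Hs.
  assert (Hd : forall k, (1 <= k <= 5)%nat ->
    ext_d (family5 (theta_1 s) theta_2 (theta_3 s) theta_4 (theta_5 s) k) p i j
    = den s (cartan_rhs k i j) p).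
  { intros k Hk; rewrite (represents_ext_d U s (ptheta k)).
    - now apply peqb_den, cartan_equations.
    - exact HU.
    - intros q Hq; apply den_theta, HU, Hq.
    - exact Hp. }
  assert (T := fun k => den_theta s p k Hs).
  assert (O := den_Omega s p).
  assert (two : den s (pquot 2 1) p = 2) by (rewrite den_pquot; field).
  assert (S2 := fun k => den_fscal s p 2 _ _ _ Hs two (O k)).
  assert (w := fun k P a Ha =>
    den_wedge s p (ptheta k) P _ a i j Hs (T k) Ha).
  repeat split.
  - etransitivity; [exact (Hd 1%nat ltac:(lia))|].
    cbn [cartan_rhs]; rewrite !den_padd.
    now rewrite <- (w 1%nat _ _ (den_fadd s p _ _ _ _ (S2 1%nat) (O 4%nat))),
      <- (w 2%nat _ _ (O 2%nat)), <- (w 3%nat _ _ (T 4%nat)).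
  - etransitivity; [exact (Hd 2%nat ltac:(lia))|].
    cbn [cartan_rhs]; rewrite !den_padd.
    now rewrite <- (w 1%nat _ _ (O 3%nat)),
      <- (w 2%nat _ _ (den_fadd s p _ _ _ _ (O 1%nat) (S2 4%nat))),
      <- (w 3%nat _ _ (T 5%nat)).
  - etransitivity; [exact (Hd 3%nat ltac:(lia))|].
    cbn [cartan_rhs]; rewrite !den_padd.
    now rewrite <- (w 1%nat _ _ (O 5%nat)), <- (w 2%nat _ _ (O 6%nat)),
      <- (w 3%nat _ _ (den_fadd s p _ _ _ _ (O 1%nat) (O 4%nat))),
      <- (w 4%nat _ _ (T 5%nat)).
  - etransitivity; [exact (Hd 4%nat ltac:(lia))|]; cbn [cartan_rhs].
    rewrite !den_padd, den_pmul, den_pquot by exact Hs.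
    now rewrite <- (w 1%nat _ _ (O 7%nat)), <- (w 3%nat _ _ (O 6%nat)),
      <- (w 4%nat _ _ (O 1%nat)), <- (w 5%nat _ _ (O 2%nat)).
  - etransitivity; [exact (Hd 5%nat ltac:(lia))|]; cbn [cartan_rhs].
    rewrite !den_padd, den_psub, den_pmul, den_pquot by exact Hs.
    now rewrite <- (w 2%nat _ _ (O 7%nat)), <- (w 3%nat _ _ (O 5%nat)),
      <- (w 4%nat _ _ (O 3%nat)), <- (w 5%nat _ _ (O 4%nat)).
Qed.

Lemma contract_fscal (c : C) (a : form) (p : point) (v : vec) :
  contract (fscal c a p) v = c * contract (a p) v.
Proof. unfold contract, fscal, sumc; ring. Qed.

Lemma contract_fadd (a b : form) (p : point) (v : vec) :
  contract (fadd a b p) v = contract (a p) v + contract (b p) v.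
Proof. unfold contract, fadd, sumc; ring. Qed.

Lemma contract_swap_lin_comb (n : nat) (c : nat -> C) (b : nat -> covec)
  (v : vec) : contract (lin_comb n c b) v =
  Csum n (fun k => c k * contract (b k) v).
Proof.
  induction n as [|n IH]; cbn [Csum].
  - unfold contract, sumc, lin_comb; cbn [Csum]; ring.
  - rewrite <- IH; unfold contract, sumc, lin_comb; cbn [Csum]; ring.
Qed.

(** A vanishing combination is paired with the adapted frame. X_1 and X_2 kill the o_i and isolate
    the coefficients of theta_4 and theta_5. These must go first, because theta_4 and theta_5 do not
    vanish on all E_i; afterwards the E_i isolate the other three. *)
Lemma theta_lin_indep (s : sign_choice) (p : point) :
  sin (p ctheta) <> 0%R -> lin_indep 5 (fun k =>
    family5 (theta_1 s) theta_2 (theta_3 s) theta_4 (theta_5 s) k p).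
Proof.
  intros Hs c Hc.
  pose proof (h_roll_neq_0 s (p cx)) as Hh.
  assert (L : forall v : vec,
    9 / 8 * c 1%nat * contract (o_1 s p) v
    + 9 / 8 * c 2%nat * contract (o_2 p) v
    + 9 / 8 * c 3%nat * contract (o_3 s p) v
    + c 4%nat * (- v cx - 3 / 4 * contract (o_2 p) v)
    + c 5%nat * (h_roll s (p cx) * v cq + 3 / 4 * contract (o_1 s p) v) = 0).
  { intro v.
    assert (H0 : contract (lin_comb 5 c (fun k =>
      family5 (theta_1 s) theta_2 (theta_3 s) theta_4 (theta_5 s) k p)) v = 0)
      by (unfold contract, sumc; rewrite !Hc; ring).
    rewrite contract_swap_lin_comb in H0; cbn [Csum family5] in H0.
    unfold theta_1, theta_2, theta_3, theta_4, theta_5 in H0.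
    rewrite !contract_fadd, !contract_fscal in H0.
    replace (contract (o_4 p) v) with (- v cx) in H0
      by (unfold contract, sumc, o_4; delta_simpl; ring).
    replace (contract (o_5 s p) v) with (h_roll s (p cx) * v cq) in H0
      by (unfold contract, sumc, o_5; delta_simpl; ring).
    rewrite <- H0; field. }
  destruct (X_1_ker_o s p Hs) as (A1 & A2 & A3).
  destruct (X_2_ker_o s p Hs) as (B1 & B2 & B3).
  assert (H4 : c 4%nat = 0).
  { pose proof (L (X_1 p)) as H; rewrite A1, A2, A3, X_1_cx, X_1_cq in H.
    transitivity (- (0 : C)); [rewrite <- H|]; ring. }
  assert (H5 : c 5%nat = 0).
  { pose proof (L (X_2 s p)) as H; rewrite B1, B2, B3, X_2_cx, X_2_cq in H.
    transitivity (0 / h_roll s (p cx)); [rewrite <- H|]; field; exact Hh. }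
  assert (D : forall (Q : pform) (E : vfield) (x y z : Z),
    represents_at s p Q E -> E p cx = 0 -> E p cq = 0 ->
    peqb (pcontract po_1 Q) (pquot x 1) = true ->
    peqb (pcontract po_2 Q) (pquot y 1) = true ->
    peqb (pcontract po_3 Q) (pquot z 1) = true ->
    IZR x * c 1%nat + IZR y * c 2%nat + IZR z * c 3%nat = 0).
  { intros Q E x y z HE Ex Eq Hx Hy Hz; pose proof (L (E p)) as H.
    rewrite (contract_eq s p _ _ _ _ _ _ Hs (den_o_1 s p Hs) HE
      (den_pquot s x 1 p) Hx),
      (contract_eq s p _ _ _ _ _ _ Hs (den_o_2 s p Hs) HE
      (den_pquot s y 1 p) Hy),
      (contract_eq s p _ _ _ _ _ _ Hs (den_o_3 s p Hs) HE
      (den_pquot s z 1 p) Hz), Ex, Eq, H4, H5 in H.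
    transitivity (8 / 9 * 0 : C); [rewrite <- H; field | ring]. }
  assert (H1 := D _ _ 1%Z 0%Z 0%Z (den_E_1 s p Hs)
    ltac:(unfold E_1; delta_simpl; ring) ltac:(unfold E_1; delta_simpl; ring)
    eq_refl eq_refl eq_refl).
  assert (H2 := D _ _ 0%Z 1%Z 0%Z (den_E_2 s p Hs)
    ltac:(unfold E_2; delta_simpl; ring) ltac:(unfold E_2; delta_simpl; ring)
    eq_refl eq_refl eq_refl).
  assert (H3 := D _ _ 0%Z 0%Z 1%Z (den_E_3 s p)
    ltac:(unfold E_3; delta_simpl; ring) ltac:(unfold E_3; delta_simpl; ring)
    eq_refl eq_refl eq_refl).
  intros k Hk; destruct k as [|[|[|[|[|[|k]]]]]]; try lia; try assumption.
  - rewrite <- H1; ring.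
  - rewrite <- H2; ring.
  - rewrite <- H3; ring.
Qed.

Lemma theta_cartan_coframe (U : point -> Prop) (s : sign_choice) :
  regular U ->
  cartan_coframe U (dist_D s) (theta_1 s) theta_2 (theta_3 s) theta_4
    (theta_5 s).
Proof.
  intro HU; split; [|split; [|split]].
  - intro k; apply (represents_smooth_field U s (ptheta k)); [exact HU|].
    intros p Hp; apply den_theta, HU, Hp.
  - intros p Hp; apply theta_lin_indep, HU, Hp.
  - intros p Hp v; rewrite (dist_D_ker s p (proj2 HU p Hp)).
    unfold ker3, theta_1, theta_2, theta_3; rewrite !contract_fscal.
    assert (E : forall z : C, z = 0 <-> 9 / 8 * z = 0).
    { intro z; split; intro H.
      - rewrite H; ring.
      - transitivity (8 / 9 * (9 / 8 * z)); [field | rewrite H; ring]. }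
    now rewrite <- !E.
  - assert (HO : forall k, smooth_field U (Omega s k)).
    { intro k; apply (represents_smooth_field U s (pOmega k)); [exact HU|].
      intros p _; apply den_Omega. }
    exists (Omega s 1), (Omega s 2), (Omega s 3), (Omega s 4), (Omega s 5),
      (Omega s 6), (Omega s 7).
    do 7 (split; [apply HO|]); now apply theta_cartan_structure.
Qed.

(** * The Cartan metric, its comparison with g, and the conclusion *)

Definition pg_cartan : ptensor2 := fun i j =>
  padd (psub (pmul (pquot 2 1) (psprod (ptheta 1) (ptheta 5) i j))
             (pmul (pquot 2 1) (psprod (ptheta 2) (ptheta 4) i j)))
       (pmul (pquot 4 3) (psprod (ptheta 3) (ptheta 3) i j)).

Lemma den_cartan_metric (s : sign_choice) (p : point) (i j : coord) :
  sin (p ctheta) <> 0%R ->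
  cartan_metric (theta_1 s) theta_2 (theta_3 s) theta_4 (theta_5 s) p i j
  = den s (pg_cartan i j) p.
Proof.
  intro Hs; unfold cartan_metric, pg_cartan; den_expand Hs.
  assert (T := fun k => den_theta s p k Hs).
  rewrite <- (den_psprod s p _ _ _ _ i j Hs (T 1%nat) (T 5%nat)),
    <- (den_psprod s p _ _ _ _ i j Hs (T 2%nat) (T 4%nat)),
    <- (den_psprod s p _ _ _ _ i j Hs (T 3%nat) (T 3%nat)).
  cbn [family5]; field.
Qed.

(** Substituting ot_1 = o_1 + 2 o_5 and ot_2 = o_2 - 2 o_4 cancels the squares of o_4 and o_5 and
    gives g = 3/2 (o_1^2 + o_2^2 + o_3^2) + 2 o_1 o_5 - 2 o_2 o_4. Expanding the theta_i yields 9/8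
    of this. *)
Lemma g_o_cartan_metric (s : sign_choice) (p : point) (i j : coord) :
  sin (p ctheta) <> 0%R ->
  g_o s p i j = 8 / 9 *
  cartan_metric (theta_1 s) theta_2 (theta_3 s) theta_4 (theta_5 s) p i j.
Proof.
  intro Hs; rewrite den_g_o, den_cartan_metric by exact Hs.
  transitivity (den s (pmul (pquot 8 9) (pg_cartan i j)) p).
  - apply peqb_den; destruct i, j; vm_compute; reflexivity.
  - den_expand Hs; reflexivity.
Qed.

Lemma smooth_const (V : point -> Prop) (c : C) :
  regular V -> smooth V (fun _ => c).
Proof.
  intros HV k; revert c; induction k as [|k IH]; intro c; cbn.
  - intros p _; apply continuous_const.
  - split; [apply IH|]; intro i; split.
    + intros p _; eapply is_pd_ex, is_pd_const.
    + apply (Ck_ext V (proj1 HV) k (fun _ => 0)); [|apply IH].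
      intros p _; symmetry; apply is_pd_unique, is_pd_const.
Qed.

Theorem theorem5p1 (U : point -> Prop) (hU : open U)
  (hsin : forall p, U p -> sin (p ctheta) <> 0%R) (s : sign_choice) :
  spans_annihilator3 U (o_1 s) o_2 (o_3 s) (dist_D s) /\
  spans_annihilator3 U (ot_1 s) ot_2 (ot_3 s) (dist_Dt s) /\
  distribution_235 U (dist_D s) /\
  maximally_symmetric U (dist_D s) /\
  nurowski_representative U (dist_D s) (g_o s) /\
  (forall p, U p -> forall i j, g_o s p i j = g_rolling s p i j) /\
  weyl_vanishes U (g_o s) /\
  conformally_flat U (g_o s).
Proof.
  assert (HU : regular U) by now split.
  assert (Hg : represents_tensor U s pg_o (g_o s))
    by (intros i j p Hp; apply den_g_o, HU, Hp).
  split; [now apply spans_annihilator_D|].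
  split; [now apply spans_annihilator_Dt|].
  split; [now apply D_235|].
  split; [|split; [|split; [|split]]].
  - intros p Hp.
    exists U, (theta_1 s), theta_2, (theta_3 s), theta_4, (theta_5 s).
    split; [exact hU|]; split; [exact Hp|]; split; [auto|].
    split; [now apply theta_cartan_coframe|].
    (* The Cartan metric is 9/8 g, so its inverse is 8/9 times that of g. *)
    apply (weyl_check_weyl_vanishes U s pg_cartan
      (fun i j => pmul (pquot 8 9) (pg_inv i j))); [exact HU| |].
    + intros i j q Hq; apply den_cartan_metric, HU, Hq.
    + vm_compute; reflexivity.
  - intros p Hp.
    exists U, (theta_1 s), theta_2, (theta_3 s), theta_4, (theta_5 s),
      (fun _ => 8 / 9).
    split; [exact hU|]; split; [exact Hp|]; split; [auto|].
    split; [now apply theta_cartan_coframe|]; split.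
    + split; [now apply smooth_const|]; intros _ _ H; apply C1_nz.
      transitivity (9 / 8 * (8 / 9)); [field | rewrite H; ring].
    + intros q Hq i j; apply g_o_cartan_metric, HU, Hq.
  - intros p Hp i j; apply g_o_g_rolling, HU, Hp.
  (* The Weyl tensor of g is computed directly; conformal invariance is not invoked. *)
  - apply (weyl_check_weyl_vanishes U s pg_o pg_inv); [exact HU | exact Hg|].
    vm_compute; reflexivity.
  - intros p Hp; exists U, (fun q => h_pow s (-2) (q cx)).
    split; [exact hU|]; split; [exact Hp|]; split; [auto|].
    assert (Hl : represents U s (p_h (-2)) (fun q => h_pow s (-2) (q cx)))
      by (intros q _; symmetry; apply den_h).
    split.
    + split; [now apply (represents_smooth U s (p_h (-2)))|].
      intros q _; apply h_pow_neq_0.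
    (* Scaling g by h^-2 scales the inverse by h^2, and the full Riemann tensor of the scaled metric
       then normalises to zero. *)
    + apply (flat_check_flat U s (fun i j => pmul (p_h (-2)) (pg_o i j))
        (fun i j => pmul (p_h 2) (pg_inv i j))); [exact HU| |].
      * intros i j q Hq; unfold rescale.
        rewrite den_pmul by (apply HU, Hq).
        now rewrite (Hl q Hq), (Hg i j q Hq).
      * vm_compute; reflexivity.
Qed.
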